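(* Let $M$ be an irreducible affine algebraic monoid over an algebraically closed field $\Bbbk$, with unit group $G$, and let $H\subset G$ be a subgroup that is closed in $M$. Then the following conditions are equivalent. (1) $H$ is observable in $M$. (2) There exist a finite dimensional rational right $M$-module $V$ and $v\in V$ such that $G_v=H$. In particular, if condition (2) holds (for $V$ and $v$), then $G_v=M_v$ is closed in $M$.
   Context: An algebraic monoid is an algebraic variety $M$ with an associative product $M\times M\to M$ that is a morphism of varieties and has a neutral element $1$. Its unit group $G=G(M)$ is an algebraic group, open in $M$. A finite dimensional rational right $M$-module is a finite dimensional $\Bbbk$-vector space $V$ with a right action $V\times M\to V$, $(v,m)\mapsto v\cdot m$, of $M$ by linear endomorphisms that is a morphism of varieties and in which $1$ acts as the identity. For $v\in V$, $G_v=\{g\in G : v\cdot g=v\}$ and $M_v=\{m\in M : v\cdot m=v\}$. A closed subgroup $H\subset G$ is observable in $M$ if the action of $H$ on $M$ by left multiplication is observable, i.e. every nonzero ideal $I\subset\Bbbk[M]$ stable under the right action $(f\cdot h)(m)=f(hm)$ of $H$ contains a nonzero $H$-invariant element. *)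

(* Defs.v *)
From HB Require Import structures.
From mathcomp Require Import all_boot all_order all_algebra.
From mathcomp Require Import mpoly.

Set Implicit Arguments.
Unset Strict Implicit.
Unset Printing Implicit Defensive.

Import GRing.Theory.
Local Open Scope ring_scope.

(* Zariski-closed subsets of affine space: common zeros of an arbitrary set S
   of polynomials. *)
Definition zero_locus (k : fieldType) (n : nat) (S : {mpoly k[n]} -> Prop)
    (a : 'rV[k]_n) : Prop :=
  forall p, S p -> p.@[a 0] = 0.

(* An affine variety is a type X together with a bijection between X and a
   Zariski-closed subset of some k^n. The chosen embedding only serves to
   single out the algebra k[X] of regular functions (regular, below). *)
HB.mixin Record isAffineVariety (k : fieldType) X := {
  adim : nat;
  acoord : X -> 'rV[k]_adim;
  acoord_inj : injective acoord;
  acoord_closed : exists S : {mpoly k[adim]} -> Prop,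
    forall a : 'rV[k]_adim, zero_locus S a <-> exists x, acoord x = a
}.

#[short(type="affineVariety")]
HB.structure Definition AffineVariety k := { X of isAffineVariety k X }.

Arguments adim {k} X : rename.
Arguments acoord {k X} x : rename.

Section Varieties.
Variable k : fieldType.
Implicit Types X Y : affineVariety k.

Definition regular X (f : X -> k) : Prop :=
  exists p : {mpoly k[adim X]}, forall x, f x = p.@[acoord x 0].

Definition var_morphism X Y (phi : X -> Y) : Prop :=
  forall f : Y -> k, regular f -> regular (fun x => f (phi x)).

Definition zariski_closed X (A : X -> Prop) : Prop :=
  exists S : (X -> k) -> Prop,
    (forall f, S f -> regular f) /\
    (forall x, A x <-> forall f, S f -> f x = 0).

Definition irreducible_variety X : Prop :=
  (exists x : X, True) /\
  forall A B : X -> Prop, zariski_closed A -> zariski_closed B ->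
    (forall x, A x \/ B x) -> (forall x, A x) \/ (forall x, B x).

Definition ideal X (I : (X -> k) -> Prop) : Prop :=
  [/\ forall f, I f -> regular f,
      I (fun _ => 0),
      forall f g, I f -> I g -> I (fun x => f x + g x)
    & forall f g, regular f -> I g -> I (fun x => f x * g x)].

End Varieties.

Section Product.
Variables (k : fieldType) (X Y : affineVariety k).

Definition prod_acoord (z : X * Y) : 'rV[k]_(adim X + adim Y) :=
  row_mx (acoord z.1) (acoord z.2).

Lemma prod_acoord_inj : injective prod_acoord.
Proof.
by move=> [x y] [x' y'] /eq_row_mx[/= /acoord_inj-> /acoord_inj->].
Qed.

Lemma prod_acoord_closed : exists S : {mpoly k[adim X + adim Y]} -> Prop,
  forall a, zero_locus S a <-> exists z, prod_acoord z = a.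
Proof.
have [SX SXP] := @acoord_closed k X; have [SY SYP] := @acoord_closed k Y.
pose lX := [tuple ('X_(lshift (adim Y) i) : {mpoly k[adim X + adim Y]})
           | i < adim X].
pose lY := [tuple ('X_(rshift (adim X) i) : {mpoly k[adim X + adim Y]})
           | i < adim Y].
have evX (q : {mpoly k[adim X]}) (a : 'rV[k]_(adim X + adim Y)) :
    (q \mPo lX).@[a 0] = q.@[lsubmx a 0].
  rewrite comp_mpoly_meval; apply: meval_eq => i.
  by rewrite tnth_mktuple mevalXU mxE.
have evY (q : {mpoly k[adim Y]}) (a : 'rV[k]_(adim X + adim Y)) :
    (q \mPo lY).@[a 0] = q.@[rsubmx a 0].
  rewrite comp_mpoly_meval; apply: meval_eq => i.
  by rewrite tnth_mktuple mevalXU mxE.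
exists (fun p => (exists2 q, SX q & p = q \mPo lX) \/
                 (exists2 q, SY q & p = q \mPo lY)) => a; split.
  move=> Sa.
  have /SXP[x xE] : zero_locus SX (lsubmx a).
    by move=> q Sq; rewrite -evX; apply: Sa; left; exists q.
  have /SYP[y yE] : zero_locus SY (rsubmx a).
    by move=> q Sq; rewrite -evY; apply: Sa; right; exists q.
  by exists (x, y); rewrite /prod_acoord xE yE hsubmxK.
case=> -[x y] <- p [] [q Sq ->].
  rewrite evX row_mxKl; suff /(_ q Sq) : zero_locus SX (acoord x) by [].
  by apply/SXP; exists x.
rewrite evY row_mxKr; suff /(_ q Sq) : zero_locus SY (acoord y) by [].
by apply/SYP; exists y.
Qed.

HB.instance Definition _ :=
  isAffineVariety.Build k (X * Y)%type prod_acoord_inj prod_acoord_closed.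

End Product.

(* A finite-dimensional vector space viewed as an affine space. *)
Definition affine_space (k : fieldType) (V : vectType k) : Type := V.

Section AffineSpace.
Variables (k : fieldType) (V : vectType k).

Definition affine_space_acoord (v : affine_space V) : 'rV[k]_(dim V) :=
  VectorInternalTheory.v2r (v : V).

Lemma affine_space_acoord_inj : injective affine_space_acoord.
Proof. exact: VectorInternalTheory.v2r_inj. Qed.

Lemma affine_space_acoord_closed : exists S : {mpoly k[dim V]} -> Prop,
  forall a, zero_locus S a <-> exists v, affine_space_acoord v = a.
Proof.
exists (fun _ => False) => a; split=> [_|_ p []].
by exists (VectorInternalTheory.r2v a); exact: VectorInternalTheory.r2vK.
Qed.

HB.instance Definition _ := isAffineVariety.Build k (affine_space V)
  affine_space_acoord_inj affine_space_acoord_closed.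

End AffineSpace.

HB.mixin Record isAlgebraicMonoid (k : fieldType) M
    of Monoid M & AffineVariety k M := {
  mulg_var_morphism :
    var_morphism (fun z : (M * M)%type => (z.1 * z.2)%g : M)
}.

#[short(type="affineMonoid")]
HB.structure Definition AffineMonoid k :=
  { M of Monoid M & AffineVariety k M & isAlgebraicMonoid k M }.

Section Monoids.
Variables (k : fieldType) (M : affineMonoid k).

Definition unit_group (g : M) : Prop :=
  exists h : M, (g * h = 1)%g /\ (h * g = 1)%g.

Definition subgroup_of_units (H : M -> Prop) : Prop :=
  [/\ forall h, H h -> unit_group h,
      H 1%g,
      forall g h, H g -> H h -> H (g * h)%g
    & forall g h, H g -> (g * h = 1)%g -> (h * g = 1)%g -> H h].

Definition stable_ideal (H : M -> Prop) (I : (M -> k) -> Prop) : Prop :=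
  forall f h, I f -> H h -> I (fun m => f (h * m)%g).

Definition invariant (H : M -> Prop) (f : M -> k) : Prop :=
  forall h m, H h -> f (h * m)%g = f m.

Definition observable_in (H : M -> Prop) : Prop :=
  forall I : (M -> k) -> Prop, ideal I -> stable_ideal H I ->
    (exists f, I f /\ exists m, f m <> 0) ->
    exists f, [/\ I f, exists m, f m <> 0 & invariant H f].

Record rational_module := RationalModule {
  rmod :> vectType k;
  ract : rmod -> M -> rmod;
  ract_linear : forall m, linear (fun v => ract v m);
  ract1 : forall v, ract v 1%g = v;
  ractM : forall v m n, ract v (m * n)%g = ract (ract v m) n;
  ract_morphism :
    var_morphism (fun z : (affine_space rmod * M)%type =>
                    ract z.1 z.2 : affine_space rmod)
}.

Definition stab_monoid (V : rational_module) (v : V) (m : M) : Prop :=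
  ract v m = v.

Definition stab_group (V : rational_module) (v : V) (g : M) : Prop :=
  unit_group g /\ ract v g = v.

End Monoids.

(* Main.v *)
(* (1) => (2).  Translates of equations of H by elements of H span a finite
   dimensional space with a basis u of functions that vanish on H; the
   determinants F of the matrices (u_i (y_j)) are multiplied by a character chi
   under translation by H, and by a nonzero scalar under translation by m only
   if m lies in H.  Observability, applied to the principal ideal generated by a
   nonzero chi-semi-invariant of k[M], gives q <> 0 of weight chi^-1.  The
   function q(y_0) F(y_1, .., y_d) on M^(d+1) then has stabilizer H in M, and its
   translates span a finite dimensional module.

   (2) => (1).  The generic lemma: for a morphism pi : M -> k^r, an ideal J and q
   in k[M], either q is torsion in k[M]/J over k[pi], or q is not in J + m_y k[M]
   for generic y = pi(g).  It is proved by pseudo-division by a Groebner basis,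
   with monomials ordered and coefficients taken modulo the polynomials vanishing
   on pi(M).  It is applied to the orbit map pi(m) = v m.

   - M_v = G_v: let d be a character of M with G = {d <> 0}.  As H = G_v is closed,
     M_v is the disjoint union of the closed sets H and M_v :&: {d = 0}, so that
     d^s is in d^(s+1) k[M] + m_v k[M] for some s; by translation the same holds
     at all points of the orbit of v, so that d^s is torsion in k[M]/(d^(s+1)):
     a nonzero a(v m) is divisible by d.  If n is in M_v and d(n) = 0, then
     a(v m) = a(v n m) = 0 for all m, a contradiction.

   - If J is H-stable and q = 1, either a(v m) is a nonzero invariant in J, or for
     generic g in G there is a zero x of J with v x = v g; then x is in H g since
     M_v = H, so that g is a zero of J, which is impossible for generic g. *)

From HB Require Import structures.
Require Import Defs.
From mathcomp Require Import all_boot all_order all_algebra.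
From mathcomp Require Import mpoly.
From mathcomp Require Import ring.
From Stdlib Require Import Classical ClassicalEpsilon FunctionalExtensionality.

Set Implicit Arguments.
Unset Strict Implicit.
Unset Printing Implicit Defensive.

Import Order.TTheory GRing.Theory VectorInternalTheory.
Local Open Scope ring_scope.

(** * Groebner bases modulo a prime ideal of the coefficients *)

(** Induction on the number of coordinates in which elements may differ: an element not above a
    fixed [m0] satisfies [m i < m0 i] for some [i], so it lies in one of finitely many slices on
    which coordinate [i] is constant. *)
Lemma dickson n (S : 'X_{1..n} -> Prop) :
  exists s : seq 'X_{1..n},
    (forall m, m \in s -> S m) /\
    (forall m, S m -> exists2 m', m' \in s & (m' <= m)%MM).
Proof.
suff main d : forall (J : {set 'I_n}) (T : 'X_{1..n} -> Prop), #|J| = d ->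
    (forall m m' i, T m -> T m' -> i \notin J -> m i = m' i) ->
    exists s : seq 'X_{1..n}, (forall m, m \in s -> T m) /\
      (forall m, T m -> exists2 m', m' \in s & (m' <= m)%MM).
  by apply: (main _ [set: 'I_n]) => // m m' i _ _; rewrite inE.
elim: d => [|d IHd] J T cardJ agree.
all: have [[m0 Tm0]|noT] := classic (exists m, T m); last first.
all: try by exists [::]; split=> // m Tm; case: noT; exists m.
  exists [:: m0]; split=> [m|m Tm]; first by rewrite inE => /eqP ->.
  exists m0; rewrite ?inE //; apply/mnm_lepP => i.
  rewrite (agree m0 m i) //; move/eqP: cardJ; rewrite cards_eq0 => /eqP ->.
  by rewrite inE.
pose slice (iv : 'I_n * nat) m := [/\ T m, iv.1 \in J & m iv.1 = iv.2].
have /choice[F FP] : forall iv : 'I_n * nat, exists s : seq 'X_{1..n},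
    (forall m, m \in s -> slice iv m) /\
    (forall m, slice iv m -> exists2 m', m' \in s & (m' <= m)%MM).
  move=> [i v]; have [iJ|niJ] := boolP (i \in J); last first.
    by exists [::]; split=> // m [_ /=]; rewrite (negPf niJ).
  apply: (IHd (J :\ i)).
    by move: cardJ; rewrite (cardsD1 i) iJ add1n => -[].
  move=> m m' j [Tm _ mi] [Tm' _ m'i]; rewrite !inE negb_and negbK.
  by case/orP=> [/eqP ->|]; [rewrite /= in mi m'i; rewrite mi m'i | exact: agree].
exists (m0 :: flatten [seq flatten [seq F (i, v) | v <- iota 0 (m0 i)]
                      | i <- enum 'I_n]); split=> [m|m Tm].
  rewrite inE => /orP[/eqP -> //|/flatten_mapP[i _ /flatten_mapP[v _]]].
  by case: (FP (i, v)) => + _ => /[apply] -[].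
have [le|/mnm_lepP nle] := boolP (m0 <= m)%MM.
  by exists m0; rewrite ?mem_head.
have [i lt_i] : exists i, (m i < m0 i)%N.
  apply: NNPP => nex; apply: nle => i; rewrite leqNgt; apply/negP => lt_i.
  by apply: nex; exists i.
have iJ : i \in J.
  by apply/negPn/negP => /(agree _ _ _ Tm Tm0) E; rewrite E ltnn in lt_i.
have [_ /(_ m)[//|m' m'F le]] := FP (i, m i).
exists m' => //; rewrite inE; apply/orP; right.
apply/flatten_mapP; exists i; first by rewrite mem_enum.
by apply/flatten_mapP; exists (m i); rewrite ?mem_iota.
Qed.

Definition is_ideal (R : comNzRingType) (I : R -> Prop) : Prop :=
  [/\ I 0, forall f g, I f -> I g -> I (f + g)
    & forall h f, I f -> I (h * f)].

Definition is_prime (R : comNzRingType) (P : R -> Prop) : Prop :=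
  [/\ is_ideal P, ~ P 1 & forall a b, P (a * b) -> P a \/ P b].

Lemma ideal_oppr (R : comNzRingType) (I : R -> Prop) f :
  is_ideal I -> I f -> I (- f).
Proof. by case=> _ _ IM If; rewrite -mulN1r; apply: IM. Qed.

Lemma ideal_subr (R : comNzRingType) (I : R -> Prop) f g :
  is_ideal I -> I f -> I g -> I (f - g).
Proof.
by move=> II If Ig; case: (II) => _ ID _; apply: ID => //; exact: ideal_oppr.
Qed.

Lemma ideal_sum (R : comNzRingType) (I : R -> Prop) J (r : seq J) (Q : pred J) F :
  is_ideal I -> (forall j, Q j -> I (F j)) -> I (\sum_(j <- r | Q j) F j).
Proof. by case=> I0 ID _ IF; elim/big_ind: _. Qed.

Lemma prime_prod (R : comNzRingType) (P : R -> Prop) (J : eqType) (r : seq J) F :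
  is_prime P -> (forall j, j \in r -> ~ P (F j)) -> ~ P (\prod_(j <- r) F j).
Proof.
case=> _ P1 PM; elim: r => [|j r IHr] nP; first by rewrite big_nil.
rewrite big_cons => /PM[]; first by apply: nP; rewrite mem_head.
by apply: IHr => i ir; apply: nP; rewrite inE ir orbT.
Qed.

Section LeadingMonomials.
Variables (A : comNzRingType) (n : nat) (P : A -> Prop).
Hypothesis primeP : is_prime P.
Implicit Types (f g : {mpoly A[n]}) (m : 'X_{1..n}).

Let idealP : is_ideal P. Proof. by case: primeP. Qed.

(** The leading monomial of the image of [f] over [A/P]. It is a relation because [P] is a mere
    predicate and the quotient is never formed. *)
Definition lead_at f m := ~ P f@_m /\ forall m', (m < m')%O -> P f@_m'.

Lemma lead_atP f : (forall m, P f@_m) \/ exists m, lead_at f m.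
Proof.
have main (s : seq 'X_{1..n}) : (forall m, m \in s -> P f@_m) \/
    exists m, ~ P f@_m /\ forall m', m' \in s -> (m < m')%O -> P f@_m'.
  elim: s => [|m s [IHs|[m1 [nP1 IHs]]]]; first by left.
    have [Pm|nPm] := classic (P f@_m).
      by left=> m'; rewrite inE => /orP[/eqP ->|/IHs].
    right; exists m; split=> // m'; rewrite inE => /orP[/eqP ->|/IHs //].
    by rewrite ltxx.
  right; have [Pm|nPm] := classic (P f@_m).
    by exists m1; split=> // m'; rewrite inE => /orP[/eqP ->|/IHs].
  case: (leP m m1) => [le1|lt1].
    exists m1; split=> // m'; rewrite inE => /orP[/eqP ->|/IHs //].
    by rewrite ltNge le1.
  exists m; split=> // m'; rewrite inE => /orP[/eqP ->|m's lt]; rewrite ?ltxx //.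
  exact: IHs (lt_trans lt1 lt).
have outP m : m \notin msupp f -> P f@_m.
  by move=> nm; rewrite memN_msupp_eq0 //; case: idealP.
case: (main (msupp f)) => [Pf|[m [nPm Pf]]]; [left|right].
  by move=> m; have [/Pf|/outP] := boolP (m \in msupp f).
exists m; split=> // m' lt; have [/Pf|/outP //] := boolP (m' \in msupp f).
exact.
Qed.

(** The monomial order is well-founded, and a polynomial whose coefficients from [m] upwards lie in
    [P] has a leading monomial below [m], or none. *)
Lemma lead_ind (Q : {mpoly A[n]} -> Prop) :
  (forall f, (forall m, P f@_m) -> Q f) ->
  (forall f m, lead_at f m ->
     (forall g, (forall m', (m <= m')%O -> P g@_m') -> Q g) -> Q f) ->
  forall f, Q f.
Proof.
move=> Q0 QS f; have [/Q0 //|[m]] := lead_atP f.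
elim/(@ltmwf n): m f => m IHm f lead_m; apply: (QS _ _ lead_m) => g Pg.
have [/Q0 //|[m' lead_m']] := lead_atP g; apply: (IHm m') => //.
by rewrite ltNge; apply/negP => /Pg; case: lead_m'.
Qed.

(** One step of pseudo-division: cross-multiplication by the leading coefficients cancels the term
    at [m] without any division in [A]. *)
Definition lead_red f m g m' : {mpoly A[n]} :=
  g@_m' *: f - f@_m *: (g * 'X_[(m - m')%MM]).

Lemma lead_red_lt f m g m' : lead_at f m -> lead_at g m' -> (m' <= m)%MM ->
  forall m1, (m <= m1)%O -> P (lead_red f m g m')@_m1.
Proof.
move=> [_ fP] [_ gP] lem m1 le1; have [P0 _ PM] := idealP.
have mE : m = (m - m' + m')%MM by rewrite submK.
rewrite mcoeffB !mcoeffZ.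
have [m1s|m1ns] := boolP (m1 \in msupp (g * 'X_[(m - m')%MM])); last first.
  rewrite [X in _ * _ - _ * X]memN_msupp_eq0 // mulr0 subr0.
  move: le1; rewrite le_eqVlt => /orP[/eqP E|/fP]; last first.
    by move=> Pf; exact: PM.
  have := m1ns; rewrite -E {1}mE mcoeff_msupp negbK mcoeffMX => /eqP ->.
  by rewrite mul0r.
move: m1s; rewrite (perm_mem (msuppMX _ _)) => /mapP[m2 _ m1E].
rewrite m1E mcoeffMX; move: le1; rewrite {1}mE m1E lemc_add2r.
rewrite le_eqVlt => /orP[/eqP <-|lt2].
  by rewrite -mE mulrC subrr.
apply: ideal_subr => //; apply: PM; last exact: gP.
by apply: fP; rewrite {1}mE ltmc_add2r.
Qed.

Lemma lead_red_ideal (I : {mpoly A[n]} -> Prop) f m g m' :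
  is_ideal I -> I f -> I g -> I (lead_red f m g m').
Proof.
move=> II If Ig; case: (II) => _ _ IM; apply: ideal_subr => //.
  by rewrite -mul_mpolyC; apply: IM.
by rewrite -mul_mpolyC mulrCA mulrC; apply: IM.
Qed.

(** Dickson's lemma for the set of leading monomials of [I]. Each basis element is stored with its
    leading monomial, which is not computable from it. *)
Lemma groebner_basis (I : {mpoly A[n]} -> Prop) :
  exists s : seq ({mpoly A[n]} * 'X_{1..n}),
    (forall b, b \in s -> I b.1 /\ lead_at b.1 b.2) /\
    (forall f m, I f -> lead_at f m -> exists2 b, b \in s & (b.2 <= m)%MM).
Proof.
have [s [sP sle]] := dickson (fun m => exists2 f, I f & lead_at f m).
have /choice[F FP] : forall m, exists f, m \in s -> I f /\ lead_at f m.
  move=> m; have [ms|_] := boolP (m \in s); last by exists 0.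
  by have [f] := sP _ ms; exists f.
exists [seq (F m, m) | m <- s]; split=> [_ /mapP[m ms ->]|f m If lead_f].
  exact: FP.
have [|m' m's le] := sle m; first by exists f.
by exists (F m', m') => //; apply/mapP; exists m'.
Qed.

(** * Pseudo-division and generic specialization *)

Section Generic.
Variables (I : {mpoly A[n]} -> Prop).
Hypothesis idealI : is_ideal I.
Hypothesis PI : forall p, P p -> I p%:MP.

Lemma ideal_coef f : (forall m, P f@_m) -> I f.
Proof.
move=> Pf; rewrite [f]mpolyE; apply: ideal_sum => // m _.
by rewrite -mul_mpolyC mulrC; have [_ _ IM] := idealI; apply/IM/PI.
Qed.

(* Pseudo-division by a Groebner basis [s]; the multiplier [a] is a product of
   leading coefficients, which is what the second component expresses. *)
Lemma normal_form (s : seq ({mpoly A[n]} * 'X_{1..n})) :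
  (forall b, b \in s -> I b.1 /\ lead_at b.1 b.2) ->
  forall f, exists a r, [/\ ~ P a,
    I (a *: f - r) & forall m b, b \in s -> (b.2 <= m)%MM -> P r@_m].
Proof.
have [P0 PD PM] := idealP; have [_ P1 PMp] := primeP; have [I0 ID IM] := idealI.
move=> sP; elim/lead_ind => [f Pf|f m lead_f IHf].
  exists 1, 0; split=> // [|m b _ _]; last by rewrite mcoeff0.
  by rewrite scale1r subr0; exact: ideal_coef.
have [[b bs le]|nb] := classic (exists2 b, b \in s & (b.2 <= m)%MM).
  have [Ib lead_b] := sP _ bs.
  have [a [r [nPa Iar rP]]] := IHf _ (lead_red_lt lead_f lead_b le).
  exists (a * b.1@_b.2), r; split=> // [/PMp[] //|]; first by case: lead_b.
  have -> : (a * b.1@_b.2) *: f - r = (a *: lead_red f m b.1 b.2 - r) +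
      (a * f@_m) *: (b.1 * 'X_[(m - b.2)%MM]).
    by rewrite /lead_red scalerBr !scalerA; ring.
  apply: ID => //; rewrite -mul_mpolyC mulrA mulrC mulrA; exact: IM.
have [|a [r [nPa Iar rP]]] := IHf (f - f@_m *: 'X_[m]).
  move=> m'; rewrite le_eqVlt mcoeffB mcoeffZ mcoeffX.
  case/orP=> [/eqP <-|lt]; first by rewrite eqxx mulr1 subrr.
  by rewrite lt_eqF // mulr0 subr0; case: lead_f => _; apply.
exists a, (r + (a * f@_m) *: 'X_[m]); split=> //.
  suff -> : a *: f - (r + (a * f@_m) *: 'X_[m]) =
    a *: (f - f@_m *: 'X_[m]) - r by [].
  by rewrite scalerBr scalerA; ring.
move=> m' b bs le; rewrite mcoeffD mcoeffZ mcoeffX.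
apply: PD; first exact: rP bs le.
have [E|_] := eqVneq m m'; last by rewrite mulr0.
by case: nb; exists b; rewrite ?E.
Qed.

(* If [q] is not a torsion element of the [A]-algebra [A[x]/I], then it does
   not vanish in the fibre of that algebra at a generic point [phi]. *)
Theorem generic_nonvanishing (q : {mpoly A[n]}) :
  (forall a, ~ P a -> ~ I (a *: q)) ->
  exists2 a, ~ P a & forall (k : fieldType) (phi : {rmorphism A -> k}),
    (forall p, P p -> phi p = 0) -> phi a != 0 ->
    forall f, I f -> map_mpoly phi f <> map_mpoly phi q.
Proof.
have [P0 PD PM] := idealP; have [_ P1 PMp] := primeP; have [I0 ID IM] := idealI.
move=> ntors; have [s [sP sle]] := groebner_basis I.
have [a [r [nPa Iar rP]]] := normal_form sP q.
have [Pr|[m0 [nPr _]]] := lead_atP r.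
  case: (ntors a nPa); rewrite -(subrK r (a *: q)); apply: ID => //.
  exact: ideal_coef.
(* Nonvanishing of [phi] at this product keeps the multiplier, one coefficient of the normal form
   and all leading coefficients of the basis alive after specialization. *)
exists (a * r@_m0 * \prod_(b <- s) b.1@_b.2).
  case/PMp=> [/PMp[]//|]; apply: prime_prod => // b bs.
  by have [_ []] := sP _ bs.
move=> k phi phiP; rewrite !rmorphM /= !mulf_eq0 !negb_or -andbA.
case/and3P=> phi_a phi_r; rewrite rmorph_prod /= => phi_s f If Efq.
have phi_b b : b \in s -> phi b.1@_b.2 != 0.
  by move=> bs; apply: contraNneq phi_s => b0; rewrite (big_rem b) //= b0 mul0r.
(* Descent on the leading monomial [m] of [h]: it is divisible by a leading monomial of the basis,
   so [r] has coefficient in [P] at [m] and [phi] kills that of [h]. The reduction of [h] then again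
   specializes to a nonzero multiple of [r]. *)
have key : forall h, I h -> forall c, c != 0 ->
    map_mpoly phi h <> c *: map_mpoly phi r.
  elim/lead_ind => [h Ph _|h m lead_h IHh Ih] c c0 E.
    move/(congr1 (mcoeff m0)): E; rewrite mcoeffZ !mcoeff_map_mpoly /= phiP //.
    by move/esym/eqP; rewrite mulf_eq0 (negPf c0) (negPf phi_r).
  have [b bs le] := sle _ _ Ih lead_h; have [Ib lead_b] := sP _ bs.
  have hm0 : phi h@_m = 0.
    move/(congr1 (mcoeff m)): E; rewrite mcoeffZ !mcoeff_map_mpoly /= => ->.
    by rewrite (phiP r@_m) ?mulr0 //; exact: rP bs le.
  apply: (IHh _ (lead_red_lt lead_h lead_b le) _ (phi b.1@_b.2 * c)).
  - exact: lead_red_ideal.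
  - by rewrite mulf_neq0 // phi_b.
  - by rewrite /lead_red raddfB /= !map_mpolyZ hm0 scale0r subr0 E scalerA.
apply: (key (a *: f - (a *: q - r))) (1) _ _.
- apply: ideal_subr => //; rewrite -mul_mpolyC; exact: IM.
- exact: oner_neq0.
- by rewrite !raddfB /= !map_mpolyZ Efq scale1r; ring.
Qed.

End Generic.
End LeadingMonomials.

(** * The Nullstellensatz *)

Lemma mmap_map_mpoly n (A : nzRingType) (B S : comNzRingType) (f : {rmorphism B -> S})
    (g : {rmorphism A -> B}) (h : 'I_n -> S) (p : {mpoly A[n]}) :
  mmap f h (map_mpoly g p) = mmap (f \o g) h p.
Proof.
rewrite /map_mpoly [mmap _ (fun i => 'X_i) p]/mmap raddf_sum; apply: eq_bigr => m _.
by rewrite /= rmorphM /= mmapC mmap1_id mmapX.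
Qed.

Definition ideal_add (R : comNzRingType) (I : R -> Prop) (t : R) (f : R) : Prop :=
  exists i h, I i /\ f = i + t * h.

Lemma ideal_add_ideal (R : comNzRingType) (I : R -> Prop) t :
  is_ideal I -> is_ideal (ideal_add I t).
Proof.
case=> I0 ID IM; split=> [|f g [i [h [Ii ->]]] [j [l [Ij ->]]]|f g [i [h [Ii ->]]]].
- by exists 0, 0; rewrite mulr0 addr0.
- by exists (i + j), (h + l); split; [exact: ID | ring].
- by exists (f * i), (f * h); split; [exact: IM | ring].
Qed.

Lemma ideal_addl (R : comNzRingType) (I : R -> Prop) t f :
  I f -> ideal_add I t f.
Proof. by exists f, 0; rewrite mulr0 addr0. Qed.

Lemma ideal_addr (R : comNzRingType) (I : R -> Prop) t :
  is_ideal I -> ideal_add I t t.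
Proof. by case=> I0 _ _; exists 0, 1; rewrite mulr1 add0r. Qed.

Section Nullstellensatz.
Variables (k : closedFieldType) (n : nat).
Implicit Types (I : {mpoly k[n]} -> Prop) (t f b : {mpoly k[n]}).

(* The values that [t] takes on the zero set of [I] are not all excluded: either
   [t] is algebraic modulo [I], and some root of its polynomial works, or it is
   transcendental, and almost every value works. *)
Lemma specialize_ideal I t : is_ideal I -> ~ I 1 ->
  exists c : k, ~ ideal_add I (t - c%:MP) 1 /\
    ((forall f, I (t * f) -> I f) -> c != 0).
Proof.
move=> II I1; have [I0 ID IM] := II.
pose ev := horner_alg t.
have [[a a0 Ia]|ntors] := classic (exists2 a : {poly k}, a != 0 & I (ev a)).
  elim: {a}_.+1 {-2}a (ltnSn (size a)) a0 Ia => // d IHd a size_a a0 Ia.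
  have [/eqP size1|/closed_rootP[c /factor_theorem[a' aE]]] := boolP (size a == 1).
    case: I1; have [c c0 aE] : exists2 c, c != 0 & a = c%:P.
      by apply/size_poly1P/eqP.
    move: Ia; rewrite aE /ev horner_algC => /(IM (c^-1%:A)).
    by rewrite -scalerAl mul1r scalerA mulVf // scale1r.
  have a'0 : a' != 0 by apply: contra_neq a0 => a'0; rewrite aE a'0 mul0r.
  have size_a' : (size a' < d)%N.
    by move: size_a; rewrite aE size_Mmonic ?monicXsubC // size_XsubC addn2.
  have evX : ev ('X - c%:P) = t - c%:MP.
    by rewrite /ev rmorphB /= horner_algX horner_algC -mul_mpolyC mulr1.
  have evE : ev a = ev a' * (t - c%:MP) by rewrite aE {1}/ev rmorphM /= -/ev evX.
  have IHa' : I (ev a') -> _ := IHd a' size_a' a'0.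
  have [[i [h [Ii E1]]]|proper] := classic (ideal_add I (t - c%:MP) 1).
    apply: IHa'; rewrite -[ev a']mulr1 E1 mulrDr mulrA -evE.
    by apply: ID; [exact: IM | rewrite mulrC; exact: IM].
  have [[c0 nzd]|nbad] := classic (c = 0 /\ forall f, I (t * f) -> I f).
    by apply: IHa'; apply: nzd; move: Ia; rewrite evE c0 subr0 mulrC.
  by exists c; split=> // nzd; apply/eqP => c0; apply: nbad.
pose PA (a : {poly k}) := a = 0.
have primeA : is_prime PA.
  split; [split|exact/eqP/oner_neq0|] => [//|a b -> ->|a b ->|a b /eqP].
  - exact: addr0.
  - exact: mulr0.
  - by rewrite mulf_eq0 => /orP[]/eqP; [left|right].
(* Transcendental case: [k[x]] becomes an algebra over [k[T]] with [T] acting as [t], and [J] is the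
   preimage of [I] in [k[T][x]]. *)
pose evm := mmap ev (fun i : 'I_n => 'X_i : {mpoly k[n]}).
pose J (F : {mpoly {poly k}[n]}) := I (evm F).
have idealJ : is_ideal J.
  split=> [|F G|F G]; rewrite /J /evm /ev ?rmorph0 ?rmorphD ?rmorphM //.
    exact: ID.
  exact: IM.
have [||a a0 aP] := @generic_nonvanishing _ _ _ primeA J idealJ _ 1.
- by move=> p ->; rewrite /J /evm /ev !rmorph0.
- move=> a a0; rewrite /J /evm mmapZ /ev rmorph1 mulr1 => Ia.
  by apply: ntors; exists a => //; apply/eqP.
have /closed_nonrootP[c] : a * 'X != 0.
  by rewrite mulf_neq0 ?polyX_eq0 //; exact/eqP.
rewrite rootM negb_or rootX => /andP[ac c0]; exists c; split=> // -[i [h [Ii E1]]].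
(* [1 - (T - c) h] evaluates to [i], which is in [I], at [T = t], but specializes to [1] at
   [T = c]. *)
apply: (aP k (horner_eval c) _ _ (1 - ('X - c%:P)%:MP * map_mpoly polyC h)).
- by move=> p ->; rewrite rmorph0.
- exact: ac.
- have idE : evm (map_mpoly polyC h) = h.
    rewrite /evm mmap_map_mpoly [RHS]mpolyE /mmap; apply: eq_bigr => m _.
    by rewrite /= /ev horner_algC mmap1_id -mul_mpolyC -scalerAl mul1r mul_mpolyC.
  rewrite /J /evm /ev raddfB /= rmorphM rmorph1 /= -/ev -/evm idE /evm mmapC.
  by rewrite raddfB /= horner_algX horner_algC -mul_mpolyC mulr1 E1 addrK.
- rewrite [RHS]rmorph1 rmorphB rmorphM rmorph1 /= map_mpolyC /= /horner_eval.
  by rewrite hornerD hornerN hornerX hornerC subrr mpolyC0 mul0r subr0.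
Qed.

(** The relations [X_i = c_i] are adjoined one coordinate at a time, keeping the ideal proper; the
    [c_i] are the coordinates of the zero. *)
Lemma weak_nullstellensatz I : is_ideal I -> ~ I 1 ->
  exists x : 'I_n -> k, forall f, I f -> f.@[x] = 0.
Proof.
move=> II I1.
have [J [II' J1 IJ JX]] : exists J : {mpoly k[n]} -> Prop,
    [/\ is_ideal J, ~ J 1, forall f, I f -> J f
      & forall i, i \in enum 'I_n -> exists c : k, J ('X_i - c%:MP)].
  elim: (enum 'I_n) => [|i s [J [IJ J1 JI JX]]]; first by exists I.
  have [c [proper _]] := specialize_ideal 'X_i IJ J1.
  exists (ideal_add J ('X_i - c%:MP)); split=> [|//|f /JI|j].
  - exact: ideal_add_ideal.
  - exact: ideal_addl.
  - rewrite inE => /orP[/eqP ->|/JX[c' Jc']]; last by exists c'; exact: ideal_addl.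
    by exists c; exact: ideal_addr.
have /choice[x xP] : forall i : 'I_n, exists c : k, J ('X_i - c%:MP).
  by move=> i; apply: JX; rewrite mem_enum.
(* [K f] says that [f] is congruent to its value at [x] modulo [J]; this holds for the variables and
   is preserved by ring operations. *)
have [J0 JD JM] := II'; pose K f := J (f - (f.@[x])%:MP).
have KM f g : K f -> K g -> K (f * g).
  move=> Kf Kg; rewrite /K mevalM mpolyCM.
  have -> : f * g - (f.@[x])%:MP * (g.@[x])%:MP =
    f * (g - (g.@[x])%:MP) + (g.@[x])%:MP * (f - (f.@[x])%:MP) by ring.
  by apply: JD; apply: JM.
have K1 : K 1 by rewrite /K meval1 subrr.
have KC c : K c%:MP by rewrite /K mevalC subrr.
have KD f g : K f -> K g -> K (f + g).
  by move=> Kf Kg; rewrite /K mevalD mpolyCD opprD addrACA; apply: JD.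
have KX i : K 'X_i by rewrite /K mevalXU; exact: xP.
have Kall f : K f.
  rewrite [f]mpolyE; apply: (big_ind K) => [|//|m _]; first exact: (KC 0).
  rewrite -mul_mpolyC; apply/KM => //; rewrite mpolyXE_id.
  apply: (big_ind K K1 KM) => i _; elim: (m i) => [|d IHd]; first by [].
  by rewrite exprS; apply: KM.
exists x => f /IJ Jf; apply/eqP/negPn/negP => fx0; apply: J1.
have := JM (f.@[x])^-1%:MP _ (ideal_subr II' Jf (Kall f)).
by rewrite subKr -mpolyCM mulVf.
Qed.

(** Applied to the saturation of [I] by [b], modulo which [b] is not a zero divisor: were it proper,
    it would have a zero at which [b] takes a nonzero value [c]. *)
Theorem nullstellensatz I b : is_ideal I ->
  (forall x : 'I_n -> k, (forall f, I f -> f.@[x] = 0) -> b.@[x] = 0) ->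
  exists s, I (b ^+ s).
Proof.
move=> II bV; have [I0 ID IM] := II; apply: NNPP => npow.
pose sat f := exists s, I (b ^+ s * f).
have idealS : is_ideal sat.
  split=> [|f g [s If] [r Ig]|f g [s Ig]].
  - by exists 0%N; rewrite mulr0.
  - exists (s + r)%N; rewrite mulrDr exprD; apply: ID; last by rewrite -mulrA; apply: IM.
    by rewrite mulrAC mulrC; apply: IM.
  - by exists s; rewrite mulrCA; apply: IM.
have [|c [proper c0]] := specialize_ideal b idealS.
  by case=> s; rewrite mulr1 => Ibs; apply: npow; exists s.
have [x xP] := weak_nullstellensatz (ideal_add_ideal (b - c%:MP) idealS) proper.
have bx0 : b.@[x] = 0.
  by apply: bV => f If; apply: xP; apply: ideal_addl; exists 0%N; rewrite mul1r.
have := xP _ (ideal_addr _ idealS); rewrite mevalB mevalC bx0 sub0r => /eqP.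
rewrite oppr_eq0; apply/negP; apply: c0 => f [s].
by rewrite mulrA -exprSr; exists s.+1.
Qed.

End Nullstellensatz.

(** * Regular functions on affine varieties *)

Section RegularFunctions.
Variables (k : fieldType) (X : affineVariety k).
Implicit Types f g : X -> k.

Lemma eq_regular f g : f =1 g -> regular f -> regular g.
Proof. by move=> E [p pE]; exists p => x; rewrite -E pE. Qed.

Lemma regular_cst (c : k) : regular (fun _ : X => c).
Proof. by exists c%:MP => x; rewrite mevalC. Qed.

Lemma regular_coord i : regular (fun x : X => acoord x 0 i).
Proof. by exists 'X_i => x; rewrite mevalXU. Qed.

Lemma regularD f g : regular f -> regular g -> regular (fun x => f x + g x).
Proof. by move=> [p pE] [q qE]; exists (p + q) => x; rewrite mevalD pE qE. Qed.

Lemma regularM f g : regular f -> regular g -> regular (fun x => f x * g x).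
Proof. by move=> [p pE] [q qE]; exists (p * q) => x; rewrite mevalM pE qE. Qed.

Lemma regularB f g : regular f -> regular g -> regular (fun x => f x - g x).
Proof. by move=> [p pE] [q qE]; exists (p - q) => x; rewrite mevalB pE qE. Qed.

Lemma regular_sum J (r : seq J) (Q : pred J) (F : J -> X -> k) :
  (forall j, regular (F j)) -> regular (fun x => \sum_(j <- r | Q j) F j x).
Proof.
move=> regF; elim: r => [|j r IHr].
  by apply: eq_regular (regular_cst 0) => x; rewrite big_nil.
have [Qj|nQj] := boolP (Q j); last first.
  by apply: eq_regular IHr => x; rewrite big_cons (negPf nQj).
by apply: eq_regular (regularD (regF j) IHr) => x; rewrite big_cons Qj.
Qed.

Lemma regular_prod J (r : seq J) (Q : pred J) (F : J -> X -> k) :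
  (forall j, regular (F j)) -> regular (fun x => \prod_(j <- r | Q j) F j x).
Proof.
move=> regF; elim: r => [|j r IHr].
  by apply: eq_regular (regular_cst 1) => x; rewrite big_nil.
have [Qj|nQj] := boolP (Q j); last first.
  by apply: eq_regular IHr => x; rewrite big_cons (negPf nQj).
by apply: eq_regular (regularM (regF j) IHr) => x; rewrite big_cons Qj.
Qed.

Lemma regularX f d : regular f -> regular (fun x => f x ^+ d).
Proof.
move=> regf; elim: d => [|d IHd]; first exact: regular_cst.
by apply: eq_regular (regularM regf IHd) => x; rewrite exprS.
Qed.

Lemma regular_meval r (p : {mpoly k[r]}) (F : 'I_r -> X -> k) :
  (forall i, regular (F i)) -> regular (fun x => p.@[F^~ x]).
Proof.
move=> regF; apply: (@eq_regular (fun x =>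
    \sum_(m <- msupp p) p@_m * \prod_i F i x ^+ m i)).
  by move=> x; rewrite mevalE.
apply: regular_sum => m; apply: regularM; first exact: regular_cst.
by apply: regular_prod => i; apply: regularX.
Qed.

Lemma regular_mulmx m n p (A : X -> 'M[k]_(m, n)) (B : X -> 'M[k]_(n, p)) :
  (forall i j, regular (fun x => A x i j)) ->
  (forall i j, regular (fun x => B x i j)) ->
  forall i j, regular (fun x => (A x *m B x) i j).
Proof.
move=> regA regB i j; apply: (@eq_regular (fun x => \sum_l A x i l * B x l j)).
  by move=> x; rewrite mxE.
by apply: regular_sum => l; apply: regularM.
Qed.

Lemma regular_det n (A : X -> 'M[k]_n) :
  (forall i j, regular (fun x => A x i j)) -> regular (fun x => \det (A x)).
Proof.
move=> regA; apply: regular_sum => s; apply: regularM; first exact: regular_cst.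
by apply: regular_prod.
Qed.

Lemma irreducible_domain f g : irreducible_variety X ->
  regular f -> regular g -> (forall x, f x * g x = 0) ->
  (forall x, f x = 0) \/ (forall x, g x = 0).
Proof.
have closed0 h : regular h -> zariski_closed (fun x : X => h x = 0).
  move=> regh; exists (fun h' => h' = h); split=> [h' -> //|x].
  by split=> [hx h' ->|->].
move=> [_ irr] regf regg fg0; apply: (irr) => [||x]; try exact: closed0.
by move/eqP: (fg0 x); rewrite mulf_eq0 => /orP[]/eqP; [left|right].
Qed.

Lemma irreducible_domain_neq0 f g : irreducible_variety X ->
  regular f -> regular g -> (exists x, f x <> 0) -> (exists x, g x <> 0) ->
  exists x, f x * g x <> 0.
Proof.
move=> irr regf regg [x fx] [y gy]; apply: NNPP => nex.
have [|f0|g0] := irreducible_domain irr regf regg.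
- by move=> z; apply: NNPP => fgz; apply: nex; exists z.
- by apply: fx.
- by apply: gy.
Qed.

(** * Ideals of [k[X]] pulled back to the polynomial ring *)

Section PulledBackIdeal.
Variable I : (X -> k) -> Prop.
Hypothesis idealI : ideal I.

Definition mpoly_ideal (p : {mpoly k[adim X]}) : Prop :=
  I (fun x => p.@[acoord x 0]).

Lemma regular_mpoly (p : {mpoly k[adim X]}) :
  regular (fun x : X => p.@[acoord x 0]).
Proof. by exists p. Qed.

Lemma mpoly_ideal_ideal : is_ideal mpoly_ideal.
Proof.
have [_ I0 ID IM] := idealI; split=> [|p q|q p]; rewrite /mpoly_ideal.
- suff -> : (fun x : X => (0 : {mpoly k[adim X]}).@[acoord x 0]) = (fun _ => 0) by [].
  by apply: functional_extensionality => x; rewrite meval0.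
- move=> /ID /[apply]; congr I.
  by apply: functional_extensionality => x; rewrite mevalD.
- move=> Ip; have := IM _ _ (regular_mpoly q) Ip; congr I.
  by apply: functional_extensionality => x; rewrite mevalM.
Qed.

Lemma mpoly_idealE f p : (forall x, f x = p.@[acoord x 0]) ->
  I f <-> mpoly_ideal p.
Proof. by move=> fE; rewrite /mpoly_ideal (functional_extensionality _ _ fE). Qed.

(** The equations of [X] restrict to the zero function, which lies in [I], so the zeros of the
    pulled-back ideal lie on [X]. *)
Lemma mpoly_ideal_point (y : 'I_(adim X) -> k) :
  (forall p, mpoly_ideal p -> p.@[y] = 0) -> exists x : X, acoord x 0 =1 y.
Proof.
have [S SP] := @acoord_closed k X => yP.
have /SP[x xE] : zero_locus S (\row_i y i).
  move=> p Sp; rewrite -[RHS](yP p).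
    by apply: meval_eq => i; rewrite mxE.
  rewrite /mpoly_ideal; have [_ I0 _ _] := idealI; congr I: I0.
  apply: functional_extensionality => x.
  suff /(_ p Sp) -> : zero_locus S (acoord x) by [].
  by apply/SP; exists x.
by exists x => i; rewrite xE mxE.
Qed.

(** A Groebner basis with [P] the zero ideal of [k]: at a zero of the basis, a reduction step
    multiplies the value of [f] by a nonzero scalar. *)
Lemma noetherian_zeros : exists N (g : 'I_N -> X -> k),
  (forall i, I (g i)) /\
  forall x, (forall i, g i x = 0) -> forall f, I f -> f x = 0.
Proof.
have primeP : is_prime (fun c : k => c = 0).
  split; [split|exact/eqP/oner_neq0|] => [//|a b -> ->|a b ->|a b /eqP].
  - exact: addr0.
  - exact: mulr0.
  - by rewrite mulf_eq0 => /orP[]/eqP; [left|right].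
have idealJ := mpoly_ideal_ideal.
have [s [sP sle]] := groebner_basis (fun c => c = 0) mpoly_ideal.
exists (size s), (fun i x => (tnth (in_tuple s) i).1.@[acoord x 0]); split.
  by move=> i; apply: (sP _ (mem_tnth _ (in_tuple s))).1.
move=> x gx f If; have [regI _ _ _] := idealI; have [p pE] := regI f If.
have {If} /= := (mpoly_idealE pE).1 If; rewrite pE {f pE}.
elim/(@lead_ind _ (adim X) _ primeP): p => [f f0 _|f m lead_f IHf If].
  by rewrite (_ : f = 0) ?meval0 //; apply/mpolyP => m; rewrite f0 mcoeff0.
have [b bs le] := sle _ _ If lead_f; have [Ib lead_b] := sP _ bs.
have := IHf _ (lead_red_lt primeP lead_f lead_b le)
  (lead_red_ideal m b.2 idealJ If Ib).
have /tnthP[i bE] : b \in in_tuple s by [].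
have := gx i; rewrite -bE mevalB !mevalZ mevalM => ->.
rewrite mul0r mulr0 subr0 => /eqP; rewrite mulf_eq0 => /orP[]/eqP //.
by case: lead_b.
Qed.

End PulledBackIdeal.
End RegularFunctions.

(** * The Nullstellensatz on an affine variety *)

Theorem variety_nullstellensatz (k : closedFieldType) (X : affineVariety k)
    (I : (X -> k) -> Prop) (b : X -> k) :
  ideal I -> regular b ->
  (forall x, (forall f, I f -> f x = 0) -> b x = 0) ->
  exists s, I (fun x => b x ^+ s).
Proof.
move=> idealI [q bE] bV.
have [y yP|s Is] := nullstellensatz (b := q) (mpoly_ideal_ideal idealI).
  have [x xE] := mpoly_ideal_point idealI yP.
  rewrite -(meval_eq _ xE) -bE; apply: bV => f If.
  have [regI _ _ _] := idealI; have [p pE] := regI f If.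
  by rewrite pE (meval_eq _ xE); apply: yP; exact: (mpoly_idealE _ pE).1 If.
exists s; apply/mpoly_idealE; last exact: Is.
by move=> x; rewrite rmorphXn /= bE.
Qed.

Corollary variety_weak_nullstellensatz (k : closedFieldType)
    (X : affineVariety k) (I : (X -> k) -> Prop) :
  ideal I -> (forall x, exists2 f, I f & f x <> 0) -> I (fun _ => 1).
Proof.
move=> idealI nz.
have [x x0|s] := variety_nullstellensatz idealI (regular_cst X 1).
- by have [f If []] := nz x; apply: x0.
- by congr I; apply: functional_extensionality => x; rewrite expr1n.
Qed.

(** * Principal ideals, ideals of fibres and generic fibres *)

Definition principal_ideal (k : fieldType) (X : affineVariety k) (d f : X -> k) : Prop :=
  exists2 b, regular b & forall x, f x = d x * b x.

Lemma principal_ideal_ideal (k : fieldType) (X : affineVariety k) (d : X -> k) :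
  regular d -> ideal (principal_ideal d).
Proof.
move=> regd; split=> [f [b rb fE]||f g [b rb fE] [c rc gE]|f g rf [c rc gE]].
- by apply: (@eq_regular _ _ (fun x => d x * b x)) => //; apply: regularM.
- by exists (fun _ => 0) => [|x]; rewrite ?mulr0 //; apply: regular_cst.
- exists (fun x => b x + c x) => [|x]; first exact: regularD.
  by rewrite fE gE mulrDr.
- exists (fun x => f x * c x) => [|x]; first exact: regularM.
  by rewrite gE mulrCA.
Qed.

(** The ideal [J + m_y k[X]] with [y = pi(x0)]; its zeros are those of [J] in the fibre of [pi]
    through [x0]. *)
Definition fiber_ideal (k : fieldType) (X : affineVariety k) r
    (pi : 'I_r -> X -> k) (J : (X -> k) -> Prop) (x0 : X) (f : X -> k) : Prop :=
  exists j (b : 'I_r -> X -> k), [/\ J j, forall i, regular (b i)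
    & forall x, f x = j x + \sum_i (pi i x - pi i x0) * b i x].

Section FiberIdeal.
Variables (k : fieldType) (X : affineVariety k) (r : nat).
Variables (pi : 'I_r -> X -> k) (J : (X -> k) -> Prop) (x0 : X).
Hypotheses (reg_pi : forall i, regular (pi i)) (idealJ : ideal J).

Lemma fiber_ideal_ideal : ideal (fiber_ideal pi J x0).
Proof.
have [regJ J0 JD JM] := idealJ.
split=> [f [j [b [Jj rb fE]]]||f g [j [b [Jj rb fE]]] [l [c [Jl rc gE]]]|].
- apply: (@eq_regular _ _ (fun x => j x + \sum_i (pi i x - pi i x0) * b i x)) => //.
  apply: regularD; first exact: regJ.
  apply: regular_sum => i; apply: regularM => //.
  by apply: regularB => //; apply: regular_cst.
- exists (fun _ => 0), (fun _ _ => 0); split=> // [i|x]; first exact: regular_cst.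
  by rewrite big1 ?addr0 // => i _; rewrite mulr0.
- exists (fun x => j x + l x), (fun i x => b i x + c i x).
  split=> [|i|x]; [exact: JD | exact: regularD | rewrite fE gE addrACA].
  by rewrite -big_split; congr (_ + _); apply: eq_bigr => i _; rewrite mulrDr.
- move=> f g rf [l [c [Jl rc gE]]].
  exists (fun x => f x * l x), (fun i x => f x * c i x).
  split=> [|i|x]; [exact: JM | exact: regularM | rewrite gE mulrDr mulr_sumr].
  by congr (_ + _); apply: eq_bigr => i _; rewrite mulrCA.
Qed.

Lemma fiber_idealW f : J f -> fiber_ideal pi J x0 f.
Proof.
move=> Jf; exists f, (fun _ _ => 0); split=> // [i|x]; first exact: regular_cst.
by rewrite big1 ?addr0 // => i _; rewrite mulr0.
Qed.

Lemma fiber_ideal_pi i : fiber_ideal pi J x0 (fun x => pi i x - pi i x0).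
Proof.
have [_ J0 _ _] := idealJ.
exists (fun _ => 0), (fun l _ => (l == i)%:R); split=> // [l|x].
  exact: regular_cst.
rewrite add0r (bigD1 i) //= eqxx mulr1 big1 ?addr0 // => l /negPf ->.
exact: mulr0.
Qed.

End FiberIdeal.

(** The coefficients are [A = k[y_1, .., y_r]], and [P] consists of the polynomials vanishing on
    [pi(X)], which is prime since [X] is irreducible. [I] is the preimage of [J] in [A[x]] under
    [y = pi]. *)
Theorem variety_generic (k : fieldType) (X : affineVariety k) r
    (pi : 'I_r -> X -> k) (J : (X -> k) -> Prop) (q : X -> k) :
  irreducible_variety X -> (forall i, regular (pi i)) -> ideal J -> regular q ->
  exists a : {mpoly k[r]}, (exists x, a.@[pi^~ x] <> 0) /\
    (J (fun x => a.@[pi^~ x] * q x) \/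
     forall x0, a.@[pi^~ x0] <> 0 -> ~ fiber_ideal pi J x0 q).
Proof.
move=> irrX regpi idealJ [q0 qE]; have [regJ J0 JD JM] := idealJ.
pose P (a : {mpoly k[r]}) := forall x, a.@[pi^~ x] = 0.
have primeP : is_prime P.
  split; [split| |] => [x|a b Pa Pb x|a b Pb x|P1|a b Pab].
  - by rewrite meval0.
  - by rewrite mevalD Pa Pb addr0.
  - by rewrite mevalM Pb mulr0.
  - have [[x _] _] := irrX; have /eqP := P1 x.
    by rewrite meval1 oner_eq0.
  - apply: (irreducible_domain irrX); try exact: regular_meval.
    by move=> x; rewrite -mevalM.
have notP a : ~ P a -> exists x, a.@[pi^~ x] <> 0.
  move=> nPa; apply: NNPP => nex; apply: nPa => x; apply: NNPP => ax.
  by apply: nex; exists x.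
pose ev (F : {mpoly {mpoly k[r]}[adim X]}) (x : X) :=
  mmap (meval (pi^~ x)) (acoord x 0) F.
have reg_ev F : regular (ev F).
  apply: regular_sum => m; apply: regularM; first exact: regular_meval.
  by apply: regular_prod => i; apply/regularX/regular_coord.
pose lift (p : {mpoly k[adim X]}) : {mpoly {mpoly k[r]}[adim X]} :=
  map_mpoly (@mpolyC r k) p.
have ev_lift p x : ev (lift p) x = p.@[acoord x 0].
  rewrite /ev /lift mmap_map_mpoly /meval /mmap; apply: eq_bigr => m _.
  by rewrite /= -/(meval _ _) mevalC.
pose I F := J (ev F).
have idealI : is_ideal I.
  split=> [|F G|F G]; rewrite /I.
  - congr J: J0; apply: functional_extensionality => x.
    by rewrite /ev rmorph0.
  - move=> /JD /[apply]; congr J; apply: functional_extensionality => x.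
    by rewrite /ev rmorphD.
  - move=> IG; have := JM _ _ (reg_ev F) IG; congr J.
    by apply: functional_extensionality => x; rewrite /ev rmorphM.
have PI p : P p -> I p%:MP.
  move=> Pp; rewrite /I; congr J: J0; apply: functional_extensionality => x.
  by rewrite /ev mmapC /= Pp.
have [[a nPa Ia]|ntors] := classic (exists2 a, ~ P a & I (a *: lift q0)).
  exists a; split; [exact: notP | left]; congr J: Ia.
  apply: functional_extensionality => x.
  by rewrite {1}/ev mmapZ -/(ev _ _) ev_lift qE.
have [a a0|a nPa aP] := generic_nonvanishing primeP idealI PI (q := lift q0).
  by move=> Ia; apply: ntors; exists a.
exists a; split; [exact: notP | right] => x0 ax0 [j [b [Jj regb qsum]]].
have /choice[b0 bE] : forall i, exists p : {mpoly k[adim X]},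
    forall x, b i x = p.@[acoord x 0] by [].
(* This lift evaluates to [j], hence lies in [I], and specializes at [y = pi(x0)] to the polynomial
   of [q]. *)
apply: (aP k (meval (pi^~ x0)) _ _
  (lift q0 - \sum_i ('X_i - (pi i x0)%:MP)%:MP * lift (b0 i))).
- by move=> p; apply.
- exact/eqP.
- rewrite /I; congr J: Jj; apply: functional_extensionality => x.
  rewrite {1}/ev raddfB /= -/(ev _ _) ev_lift -qE qsum.
  rewrite [mmap _ _ (\sum_i _)]raddf_sum /=.
  rewrite [X in _ - X](eq_bigr (fun i => (pi i x - pi i x0) * b i x)) ?addrK //.
  move=> i _; rewrite rmorphM /= mmapC -/(ev _ _) ev_lift -bE /=.
  by rewrite mevalB mevalXU mevalC.
- rewrite raddfB /= [X in _ - X]raddf_sum big1 ?subr0 // => i _.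
  by rewrite /= rmorphM /= map_mpolyC /= mevalB mevalXU mevalC subrr mpolyC0 mul0r.
Qed.

(** * Functions spanning a finite dimensional space *)

Lemma var_morphism_coord (k : fieldType) (X Y : affineVariety k) (phi : X -> Y) :
  (forall i, regular (fun x => acoord (phi x) 0 i)) -> var_morphism phi.
Proof.
move=> regphi f [p pE]; apply: eq_regular (regular_meval p regphi) => x.
by rewrite pE.
Qed.

Section Morphisms.
Variables (k : fieldType) (X Y : affineVariety k).

Lemma acoord_pairl (x : X) (y : Y) i :
  acoord ((x, y) : (X * Y)%type) 0 (lshift (adim Y) i) = acoord x 0 i.
Proof. exact: row_mxEl. Qed.

Lemma acoord_pairr (x : X) (y : Y) i :
  acoord ((x, y) : (X * Y)%type) 0 (rshift (adim X) i) = acoord y 0 i.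
Proof. exact: row_mxEr. Qed.

Lemma var_morphism_fst : var_morphism (fun z : (X * Y)%type => z.1).
Proof.
apply: var_morphism_coord => i.
apply: eq_regular (regular_coord (lshift (adim Y) i)) => -[x y].
by rewrite acoord_pairl.
Qed.

Lemma var_morphism_snd : var_morphism (fun z : (X * Y)%type => z.2).
Proof.
apply: var_morphism_coord => i.
apply: eq_regular (regular_coord (rshift (adim X) i)) => -[x y].
by rewrite acoord_pairr.
Qed.

Lemma var_morphism_pair (x : X) : var_morphism (fun y : Y => (x, y) : (X * Y)%type).
Proof.
apply: var_morphism_coord => i; case: (splitP i) => j jE.
  apply: eq_regular (regular_cst Y (acoord x 0 j)) => y.
  by rewrite (ord_inj (jE : val i = val (lshift (adim Y) j))) acoord_pairl.
apply: eq_regular (regular_coord j) => y.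
by rewrite (ord_inj (jE : val i = val (rshift (adim X) j))) acoord_pairr.
Qed.

End Morphisms.

Lemma regular_scalar (k : fieldType) (V : vectType k) (l : {scalar V}) :
  regular (l : affine_space V -> k).
Proof.
pose e (i : 'I_(dim V)) := r2v (delta_mx 0 i) : V.
apply: (@eq_regular _ _ (fun v : affine_space V =>
    \sum_i acoord v 0 i * l (e i))).
  move=> v; rewrite -[in RHS](v2rK v).
  rewrite [in RHS](row_sum_delta (v2r v)).
  by rewrite !linear_sum; apply: eq_bigr => i _; rewrite !linearZ.
apply: regular_sum => i; apply: regularM; last exact: regular_cst.
exact: regular_coord.
Qed.

(** * Separation of variables and finite rank *)

Section Separable.
Variables (k : fieldType) (X : affineVariety k) (Y : Type).
Implicit Types F G : X -> Y -> k.

(** Membership in the tensor product of [k[X]] with all functions on [Y]. [Y] is a bare type, so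
    that it may consist of tuples of points. *)
Definition separable F : Prop :=
  exists (I : finType) (a : I -> X -> k) (b : I -> Y -> k),
    (forall i, regular (a i)) /\ forall x y, F x y = \sum_i a i x * b i y.

Lemma eq_separable F G : (forall x y, F x y = G x y) -> separable F -> separable G.
Proof.
by move=> E [I [a [b [ra abE]]]]; exists I, a, b; split=> // x y; rewrite -E.
Qed.

Lemma separable_cst c : separable (fun _ _ => c).
Proof.
exists unit, (fun _ _ => c), (fun _ _ => 1); split=> [_|x y].
  exact: regular_cst.
by rewrite (big_pred1 tt) ?mulr1 // => -[].
Qed.

Lemma separableD F G : separable F -> separable G ->
  separable (fun x y => F x y + G x y).
Proof.
move=> [I [a [b [ra abE]]]] [J [c [d [rc cdE]]]].
exists (I + J)%type,
  (fun ij => match ij with inl i => a i | inr j => c j end),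
  (fun ij => match ij with inl i => b i | inr j => d j end).
by split=> [[]|x y] //; rewrite big_sumType abE cdE.
Qed.

Lemma separableM F G : separable F -> separable G ->
  separable (fun x y => F x y * G x y).
Proof.
move=> [I [a [b [ra abE]]]] [J [c [d [rc cdE]]]].
exists (I * J)%type, (fun ij x => a ij.1 x * c ij.2 x),
  (fun ij y => b ij.1 y * d ij.2 y).
split=> [ij|x y]; first exact: regularM.
rewrite abE cdE big_distrlr pair_bigA; apply: eq_bigr => ij _ /=.
by rewrite mulrACA.
Qed.

Lemma separable_sum (I : Type) (r : seq I) (F : I -> X -> Y -> k) :
  (forall i, separable (F i)) -> separable (fun x y => \sum_(i <- r) F i x y).
Proof.
move=> sF; elim: r => [|i r IHr].
  by apply: eq_separable (separable_cst 0) => x y; rewrite big_nil.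
by apply: eq_separable (separableD (sF i) IHr) => x y; rewrite big_cons.
Qed.

Lemma separable_prod (I : Type) (r : seq I) (F : I -> X -> Y -> k) :
  (forall i, separable (F i)) -> separable (fun x y => \prod_(i <- r) F i x y).
Proof.
move=> sF; elim: r => [|i r IHr].
  by apply: eq_separable (separable_cst 1) => x y; rewrite big_nil.
by apply: eq_separable (separableM (sF i) IHr) => x y; rewrite big_cons.
Qed.

Lemma separable_det n (F : X -> Y -> 'M[k]_n) :
  (forall i j, separable (fun x y => F x y i j)) ->
  separable (fun x y => \det (F x y)).
Proof.
move=> sF; apply: separable_sum => s; apply: separableM.
  exact: separable_cst.
exact: separable_prod.
Qed.

Lemma separable_regular F y : separable F -> regular (F^~ y).
Proof.
move=> [I [a [b [ra abE]]]].
apply: (@eq_regular _ _ (fun x => \sum_i a i x * b i y)) => //.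
by apply: regular_sum => i; apply: regularM => //; apply: regular_cst.
Qed.

End Separable.

Lemma regular_separable (k : fieldType) (X Y : affineVariety k)
    (f : (X * Y)%type -> k) :
  regular f -> separable (fun x y => f (x, y)).
Proof.
move=> [p pE]; apply: (@eq_separable _ _ _ (fun x y => \sum_(m <- msupp p)
    p@_m * ((\prod_i acoord x 0 i ^+ m (lshift (adim Y) i)) *
            (\prod_j acoord y 0 j ^+ m (rshift (adim X) j))))).
  move=> x y; rewrite pE mevalE; apply: eq_bigr => m _; congr (_ * _).
  rewrite big_split_ord /=; congr (_ * _); apply: eq_bigr => i _.
    by rewrite acoord_pairl.
  by rewrite acoord_pairr.
apply: separable_sum => m; apply: separableM; first exact: separable_cst.
exists unit, (fun _ x => \prod_i acoord x 0 i ^+ m (lshift (adim Y) i)),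
  (fun _ y => \prod_j acoord y 0 j ^+ m (rshift (adim X) j)).
split=> [_|x y]; last by rewrite (big_pred1 tt) // => -[].
by apply: regular_prod => i; apply/regularX/regular_coord.
Qed.

(* [u] and [p] index a nonvanishing minor of maximal size of the matrix with
   entries [t y], for [T t] and [y : Y]. *)
Lemma finite_rank_basis (k : fieldType) (Y : Type) (T : (Y -> k) -> Prop)
    (I : finType) (b : I -> Y -> k) :
  (forall t, T t -> exists c : I -> k, forall y, t y = \sum_i c i * b i y) ->
  exists n (u : 'I_n -> Y -> k) (p : 'I_n -> Y),
    let U := \matrix_(i, j) u i (p j) in
    [/\ forall i, T (u i), U \in unitmx
      & forall t, T t -> forall y,
          t y = (\row_j t (p j) *m invmx U *m \col_i u i y) 0 0].
Proof.
move=> span.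
pose Q n := exists (u : 'I_n -> Y -> k) (p : 'I_n -> Y),
  (forall i, T (u i)) /\ \matrix_(i, j) u i (p j) \in unitmx.
(* The matrix factors through [k^I], which bounds its rank, so that a maximal size exists. *)
have bound n : Q n -> (n <= #|I|)%N.
  move=> [u [p [Tu unitU]]].
  have /choice[c cE] : forall i, exists c : I -> k,
      forall y, u i y = \sum_l c l * b l y by move=> i; apply: span.
  pose C : 'M[k]_(n, #|I|) := \matrix_(i, l) c i (enum_val l).
  pose B : 'M[k]_(#|I|, n) := \matrix_(l, j) b (enum_val l) (p j).
  have UE : \matrix_(i, j) u i (p j) = C *m B.
    apply/matrixP => i j; rewrite !mxE cE (reindex _ (onW_bij _ (@enum_val_bij I))).
    by apply: eq_bigr => l _; rewrite !mxE.
  rewrite -{1}(mxrank_unit unitU) UE.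
  exact: leq_trans (mxrankM_maxl _ _) (rank_leq_col _).
have [n [Qn nQn]] : exists n, Q n /\ ~ Q (n + 1)%N.
  apply: NNPP => nex; have Qall n : Q n.
    elim: n => [|n Qn].
      have no (i : 'I_0) : False by case: i.
      exists (fun i => False_rect _ (no i)), (fun i => False_rect _ (no i)).
      by split=> [[]|] //; rewrite unitmxE det_mx00 unitr1.
    rewrite -addn1; apply: NNPP => nQ; apply: nex; by exists n.
  by have := bound _ (Qall #|I|.+1); rewrite ltnn.
have [u [p [Tu unitU]]] := Qn; exists n, u, p; split=> // t Tt y.
set U := \matrix_(i, j) _ in unitU *; apply/eqP; rewrite -subr_eq0.
set r := \row_j _; set c := \col_i _.
apply/negPn/negP => nz; apply: nQn.
exists (fun i => match split i with inl i => u i | inr _ => t end),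
  (fun j => match split j with inl j => p j | inr _ => y end).
split=> [i|]; first by case: (split i).
set U' := \matrix_(i, j) _.
have U'E : U' = block_mx U c r (t y)%:M.
  apply/matrixP => i j; rewrite mxE -[i]splitK -[j]splitK !unsplitK.
  case: (split i) => i'; case: (split j) => j' /=.
  - by rewrite block_mxEul mxE.
  - by rewrite block_mxEur mxE.
  - by rewrite block_mxEdl mxE.
  - by rewrite block_mxEdr !ord1 mxE.
(* A column operation clears the border [c] and leaves the Schur complement [t y - r U^-1 c],
   assumed nonzero, in the corner: [U'] would be a larger invertible minor. *)
have := unitmx_mul U' (block_mx 1%:M (- (invmx U *m c)) 0 1%:M).
rewrite [X in _ && X]unitmxE det_ublock !det1 mulr1 unitr1 andbT => <-.
rewrite U'E mulmx_block !mulmx1 !mulmx0 !addr0 !mulmxN mulmxA mulmxV //.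
rewrite mul1mx addNr unitmxE det_lblock unitrM -unitmxE unitU /=.
rewrite det_mx11 unitfE mulmxA addrC.
suff <- : t y - (r *m invmx U *m c) 0 0 =
  ((t y)%:M - r *m invmx U *m c) 0 0 by [].
by rewrite [RHS]mxE [in RHS]mxE [X in _ = _ + X]mxE mulr1n.
Qed.

(** * Representations of affine monoids *)

Section Representations.
Variables (k : fieldType) (M : affineMonoid k).

Definition matrix_representation n (A : M -> 'M[k]_n) : Prop :=
  [/\ forall i j, regular (fun m => A m i j), A 1%g = 1%:M
    & forall m m', A (m * m')%g = A m *m A m'].

(* The translates [y |-> Phi j (act m y)] span a finite dimensional module, with
   basis [u] and matrices [A]. *)
Lemma translates_representation (Y : Type) (act : M -> Y -> Y) (J : Type)
    (Phi : J -> Y -> k) (I : finType) (b : I -> Y -> k) :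
  (forall y, act 1%g y = y) ->
  (forall m m' y, act (m * m')%g y = act m (act m' y)) ->
  (forall j y, regular (fun m => Phi j (act m y))) ->
  (forall j m, exists c : I -> k,
     forall y, Phi j (act m y) = \sum_i c i * b i y) ->
  exists n (u : Y -> 'cV[k]_n) (A : M -> 'M[k]_n),
    [/\ matrix_representation A, forall m y, u (act m y) = A m *m u y,
        forall r : 'rV_n, (forall y, r *m u y = 0) -> r = 0
      & forall j, exists r : 'rV_n, forall y, Phi j y = (r *m u y) 0 0].
Proof.
move=> act1 actM regPhi span.
pose T (t : Y -> k) := exists j m, t = fun y => Phi j (act m y).
have spanT t : T t -> exists c : I -> k, forall y, t y = \sum_i c i * b i y.
  by move=> [j [m ->]]; apply: span.
have [n [u [p [Tu unitU tE]]]] := finite_rank_basis spanT.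
set U := \matrix_(i, j) _ in unitU tE.
pose w y := \col_i u i y.
have Tact t m : T t -> T (fun y => t (act m y)).
  move=> [j [m' ->]]; exists j, (m' * m)%g.
  by apply: functional_extensionality => y; rewrite actM.
pose B m : 'M[k]_n := \matrix_(i, j) u i (act m (p j)).
pose A m := B m *m invmx U.
(* Linear independence of the basis, read off at the points [p j]; multiplicativity of [A] follows
   from it. *)
have wU (r : 'rV[k]_n) : (forall y, r *m w y = 0) -> r = 0.
  move=> rw; have rU : r *m U = 0.
    apply/rowP => j; have /matrixP/(_ 0 0) := rw (p j).
    rewrite [RHS]mxE => rw0; rewrite [RHS]mxE -[RHS]rw0 [LHS]mxE [RHS]mxE.
    by apply: eq_bigr => l _; rewrite !mxE.
  by rewrite -[r](mulmxK unitU) rU mul0mx.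
have wA m y : w (act m y) = A m *m w y.
  apply/colP => i; rewrite mxE (tE _ (Tact _ m (Tu i)) y) /A.
  have -> : \row_j u i (act m (p j)) = row i (B m) by apply/rowP => j; rewrite !mxE.
  by rewrite -!row_mul mxE.
have wA_inj m m' : (forall y, A m *m w y = A m' *m w y) -> A m = A m'.
  move=> E; apply/row_matrixP => i; apply/eqP; rewrite -subr_eq0 -linearB /=.
  apply/eqP/wU => y; rewrite -row_mul mulmxBl E subrr; exact: linear0.
have A1 : A 1%g = 1%:M.
  rewrite /A (_ : B 1%g = U) ?mulmxV //.
  by apply/matrixP => i j; rewrite !mxE act1.
exists n, w, A; split=> //; first split=> //.
- apply: regular_mulmx => i j; last exact: regular_cst.
  have [l [m' uE]] := Tu i.
  apply: (@eq_regular _ _ (fun m => (fun m0 => Phi l (act m0 (p j))) (m' * m)%g)).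
    by move=> m; rewrite mxE uE actM.
  have := @mulg_var_morphism k M _ (regPhi l (p j)).
  by move/(var_morphism_pair m').
- move=> m m'; apply/row_matrixP => i; apply/eqP.
  rewrite -subr_eq0 -linearB /=; apply/eqP/wU => y.
  rewrite -row_mul mulmxBl -wA actM !wA mulmxA subrr; exact: linear0.
- move=> j; have Tj : T (Phi j).
    exists j, 1%g; apply: functional_extensionality => y; by rewrite act1.
  by exists (\row_l Phi j (p l) *m invmx U) => y; rewrite (tE _ Tj).
Qed.

Lemma mulg_separable (f : M -> k) :
  regular f -> separable (fun m m' => f (m * m')%g).
Proof. by move=> /(@mulg_var_morphism k M)/regular_separable. Qed.

Lemma separable_span (X : affineVariety k) (Y : Type) (J : finType)
    (F : J -> X -> Y -> k) :
  (forall j, separable (F j)) ->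
  exists (I : finType) (b : I -> Y -> k), forall j x,
    exists c : I -> k, forall y, F j x y = \sum_i c i * b i y.
Proof.
move=> sF; pose G (s : seq J) := exists (I : finType) (b : I -> Y -> k),
  forall j x, j \in s -> exists c : I -> k, forall y, F j x y = \sum_i c i * b i y.
suff [I [b bP]] : G (enum J).
  by exists I, b => j x; apply: bP; rewrite mem_enum.
elim: (enum J) => [|j s [I [b bP]]]; first by exists void, (fun _ _ => 0).
have [I' [a' [b' [_ b'E]]]] := sF j.
exists (I + I')%type, (fun i => match i with inl i => b i | inr i => b' i end).
move=> j' x; rewrite inE => /orP[/eqP ->|/(bP _ x)[c cE]].
  exists (fun i => match i with inl _ => 0 | inr i => a' i x end) => y.
  by rewrite big_sumType b'E /= [X in X + _]big1 ?add0r // => i _; rewrite mul0r.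
exists (fun i => match i with inl i => c i | inr _ => 0 end) => y.
by rewrite big_sumType cE /= [X in _ + X]big1 ?addr0 // => i _; rewrite mul0r.
Qed.

(* In particular [A] is faithful. *)
Lemma coordinate_representation : exists n (A : M -> 'M[k]_n)
    (r : 'I_(adim M) -> 'rV[k]_n) (c : 'cV[k]_n),
  matrix_representation A /\
  forall m i, acoord m 0 i = (r i *m A m *m c) 0 0.
Proof.
pose F (i : 'I_(adim M)) (m m' : M) := acoord (m * m')%g 0 i.
have sF i : separable (F i) by exact: mulg_separable (regular_coord i).
have [I [b bP]] := separable_span sF.
have [n [u [A [repA uA _ rP]]]] := translates_representation
  (act := fun m m' : M => (m * m')%g) (Phi := fun i m => acoord m 0 i)
  (@mul1g M) (fun m m' y => esym (mulgA m m' y))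
  (fun i y => separable_regular y (sF i)) bP.
have /choice[r rE] := rP.
exists n, A, r, (u 1%g); split=> // m i.
by rewrite rE -mulmxA -uA mulg1.
Qed.

Lemma unit_group_invertible n (A : M -> 'M[k]_n) m :
  matrix_representation A -> unit_group m -> A m \in unitmx.
Proof.
move=> [_ A1 AM] [m' [mm' _]].
by case: (@mulmx1_unit _ _ (A m) (A m')) => //; rewrite -AM mm'.
Qed.

(* [sigma ((A m)^-s A x)] vanishes at [x = m^t] for [t >= s]. By Noetherianity
   these conditions, for all [s], follow from finitely many of them, hence also
   hold for [s = t + 1] when [t] is large. *)
Lemma inverse_in_closure n (A : M -> 'M[k]_n) m (sigma : 'M[k]_n -> k) :
  matrix_representation A -> A m \in unitmx ->
  (forall D : 'M[k]_n, regular (fun x => sigma (D *m A x))) ->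
  (forall x, sigma (A x) = 0) -> sigma (invmx (A m)) = 0.
Proof.
move=> [_ A1 AM] unitA reg_sigma sigma0.
pose C := invmx (A m); pose D s := iter s (mulmxr C) (1%:M : 'M[k]_n).
pose pow s := iter s (fun x : M => m * x)%g 1%g.
have powS s : A (pow s.+1) = A m *m A (pow s) by rewrite /= AM.
have DS s : D s.+1 = D s *m C by [].
have CA : C *m A m = 1%:M by rewrite mulVmx.
have DA s t : D s *m A (pow (s + t)%N) = A (pow t).
  elim: s => [|s IHs]; first by rewrite mul1mx.
  by rewrite DS addSn powS mulmxA -[D s *m C *m A m]mulmxA CA mulmx1.
have DSA s : D s.+1 *m A (pow s) = C.
  elim: s => [|s IHs]; first by rewrite DS mul1mx A1 mulmx1.
  by rewrite DS powS mulmxA -[D s.+1 *m C *m A m]mulmxA CA mulmx1.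
pose I (f : M -> k) := regular f /\ exists N : nat, forall x,
  (forall s, (s < N)%N -> sigma (D s *m A x) = 0) -> f x = 0.
have idealI : ideal I.
  split=> [f []| |f g [rf [N fN]] [rg [N' gN]]|f g rf [rg [N gN]]] //.
  - by split; [exact: regular_cst | exists 0%N].
  - split; [exact: regularD | exists (maxn N N') => x xN].
    rewrite fN ?gN ?addr0 // => s lt; apply: xN.
      by rewrite (leq_trans lt) ?leq_maxr.
    by rewrite (leq_trans lt) ?leq_maxl.
  - by split; [exact: regularM | exists N => x xN; rewrite gN ?mulr0].
have [r [g [Ig gV]]] := noetherian_zeros idealI.
have /choice[N NP] := fun i => (Ig i).2.
pose t := (\max_i N i)%N.
rewrite -/C -(DSA t).
apply: (gV (pow t) _ (fun x => sigma (D t.+1 *m A x))).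
  move=> i; apply: NP => s lt.
  have le : (s <= t)%N by apply: leq_trans (ltnW lt) (leq_bigmax i).
  by rewrite -(subnKC le) DA.
split=> //; exists t.+2 => x; apply; exact: ltnSn.
Qed.

(** The determinant of a faithful representation [A]. If [A m] is invertible, its inverse satisfies
    every polynomial relation that holds on [A(M)], hence the equations of [M], and so comes from a
    point of [M]. *)
Lemma unit_character : exists d : M -> k,
  [/\ regular d, d 1%g = 1, forall m m', d (m * m')%g = d m * d m'
    & forall m, unit_group m <-> d m != 0].
Proof.
have [n [A [r [c [repA rE]]]]] := coordinate_representation.
have [regA A1 AM] := repA.
exists (fun m => \det (A m)); split.
- exact: regular_det.
- by rewrite A1 det1.
- by move=> m m'; rewrite AM det_mulmx.
move=> m; split=> [um|dm].
  by rewrite -unitfE -unitmxE; apply: unit_group_invertible.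
have unitA : A m \in unitmx by rewrite unitmxE unitfE.
have faithful x y : A x = A y -> x = y.
  by move=> E; apply/acoord_inj/rowP => i; rewrite !rE E.
pose L (B : 'M[k]_n) : 'rV_(adim M) := \row_i (r i *m B *m c) 0 0.
have LA x : L (A x) = acoord x by apply/rowP => i; rewrite mxE rE.
have regDA (D : 'M[k]_n) i j : regular (fun x => (D *m A x) i j).
  by apply: regular_mulmx => // i' j'; apply: regular_cst.
have regL (D : 'M[k]_n) i : regular (fun x => L (D *m A x) 0 i).
  apply: (@eq_regular _ _ (fun x => (r i *m (D *m A x) *m c) 0 0)).
    by move=> x; rewrite [RHS]mxE.
  apply: regular_mulmx => i' j'; last exact: regular_cst.
  by apply: regular_mulmx => // i0 j0; apply: regular_cst.
have [S SP] := @acoord_closed k M.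
have /SP[y yE] : zero_locus S (L (invmx (A m))).
  move=> p Sp; apply: (inverse_in_closure (sigma := fun B => p.@[L B 0]) repA) => //.
    by move=> D; apply: (@regular_meval _ _ _ p (fun i x => L (D *m A x) 0 i)).
  move=> x; rewrite LA; suff /(_ p Sp) : zero_locus S (acoord x) by [].
  by apply/SP; exists x.
(* That the entries of [A] are polynomials in the coordinates is again a relation on [A(M)], so it
   passes to the inverse. *)
have Ay : A y = invmx (A m).
  apply/matrixP => i j; have [p pE] := regA i j; rewrite pE yE.
  apply/eqP; rewrite -subr_eq0; apply/eqP.
  apply: (inverse_in_closure (sigma := fun B => p.@[L B 0] - B i j) repA) => //.
    move=> D; apply: regularB => //.
    by apply: (@regular_meval _ _ _ p (fun i x => L (D *m A x) 0 i)).
  by move=> x; rewrite LA -pE subrr.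
exists y; split; apply: faithful; rewrite AM A1 Ay.
  exact: mulmxV.
exact: mulVmx.
Qed.

(** * Rational modules from matrix representations *)

Section RepresentationModule.
Variables (n : nat) (A : M -> 'M[k]_n).
Hypothesis repA : matrix_representation A.

Definition rep_act (v : 'rV[k]_n) (m : M) : 'rV[k]_n := v *m A m.

Lemma rep_act_linear m : linear (rep_act^~ m).
Proof. by move=> a u v; rewrite /rep_act mulmxDl scalemxAl. Qed.

Lemma rep_act1 v : rep_act v 1%g = v.
Proof. by rewrite /rep_act; case: repA => _ -> _; rewrite mulmx1. Qed.

Lemma rep_actM v m m' : rep_act v (m * m')%g = rep_act (rep_act v m) m'.
Proof. by rewrite /rep_act; case: repA => _ _ ->; rewrite mulmxA. Qed.

Lemma rep_act_morphism :
  var_morphism (fun z : (affine_space 'rV[k]_n * M)%type =>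
                  rep_act z.1 z.2 : affine_space 'rV[k]_n).
Proof.
have [regA _ _] := repA; apply: var_morphism_coord => i.
(* The coordinates of [affine_space] are those of [v2r], so matrix entries must be converted by
   [e]. *)
pose e (l : 'I_n) := v2r (delta_mx 0 l : 'rV[k]_n) 0 i.
apply: (@eq_regular _ _ (fun z : (affine_space 'rV[k]_n * M)%type =>
    \sum_l (\sum_j (z.1 : 'rV[k]_n) 0 j * A z.2 j l) * e l)).
  move=> [v m]; rewrite -[RHS]/(v2r (rep_act v m) 0 i).
  rewrite [in RHS](row_sum_delta (rep_act v m)) linear_sum summxE.
  by apply: eq_bigr => l _; rewrite linearZ /= [RHS]mxE mxE.
apply: regular_sum => l; apply: regularM; last exact: regular_cst.
apply: regular_sum => j; apply: regularM.
  pose coordj := fun v : 'rV[k]_n => v 0 j.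
  have lin : scalar coordj by move=> a u v; rewrite /coordj !mxE.
  pose l' : {scalar 'rV[k]_n} :=
    HB.pack coordj (GRing.isLinear.Build _ _ _ _ coordj lin).
  exact: var_morphism_fst (regular_scalar l').
exact: var_morphism_snd (regA j l).
Qed.

Definition rep_module : rational_module M :=
  RationalModule rep_act_linear rep_act1 rep_actM rep_act_morphism.

End RepresentationModule.
End Representations.

(** * Observable subgroups and stabilizers *)

(** Cramer's rule: these determinants are the entries of [\adj B *m c]. *)
Lemma det_replace_col_eq0 (k : fieldType) d (B : 'M[k]_d) (c : 'cV[k]_d) :
  \det B != 0 ->
  (forall j0, \det (\matrix_(i, j) if j == j0 then c i 0 else B i j) = 0) ->
  c = 0.
Proof.
move=> detB detc; have adjc : \adj B *m c = 0.
  apply/colP => j; rewrite [RHS]mxE -[RHS](detc j) (expand_det_col _ j) mxE.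
  apply: eq_bigr => i _; rewrite [\adj B _ _]mxE mulrC mxE eqxx; congr (_ * _).
  rewrite /cofactor; congr (_ * \det _); apply/matrixP => i' j'.
  by rewrite !mxE eq_sym (negPf (neq_lift _ _)).
have : \det B *: c = 0 by rewrite -mul_scalar_mx -mul_mx_adj -mulmxA adjc mulmx0.
by move/eqP; rewrite scaler_eq0 (negPf detB) => /eqP.
Qed.

Section Translations.
Variables (k : fieldType) (M : affineMonoid k).

Lemma regular_mulgl (f : M -> k) m : regular f -> regular (fun x => f (m * x)%g).
Proof. by move=> /(@mulg_var_morphism k M)/(var_morphism_pair m). Qed.

Lemma regular_mulgr (f : M -> k) m : regular f -> regular (fun x => f (x * m)%g).
Proof. by move=> /mulg_separable/(separable_regular m). Qed.

End Translations.

(** * Orbit maps *)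

Section OrbitMap.
Variables (k : fieldType) (M : affineMonoid k) (V : rational_module M) (v : V).

Definition orbit_coord (i : 'I_(dim V)) (m : M) : k := v2r (ract v m) 0 i.

Lemma orbit_coord_regular i : regular (orbit_coord i).
Proof.
have := ract_morphism (@regular_coord k (affine_space V) i).
by move/(var_morphism_pair (v : affine_space V)).
Qed.

Lemma orbit_coord_eq m m' :
  (forall i, orbit_coord i m = orbit_coord i m') -> ract v m = ract v m'.
Proof. by move=> E; apply/v2r_inj/rowP. Qed.

(** As [g] acts linearly on [V], translation by [g] carries equations of one fibre of the orbit map
    to combinations of equations of another. *)
Lemma orbit_coord_mulg g m m' i :
  orbit_coord i (m * g)%g - orbit_coord i (m' * g)%g =
  \sum_l (orbit_coord l m - orbit_coord l m') *
         v2r (ract (r2v (delta_mx 0 l) : V) g) 0 i.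
Proof.
pose f := fun u : V => v2r (ract u g) 0 i.
have lin : scalar f.
  by move=> a u w; rewrite /f ract_linear linearP !mxE.
pose F : {scalar V} := HB.pack f (GRing.isLinear.Build _ _ _ _ f lin).
rewrite /orbit_coord !ractM -[LHS]/(F (ract v m) - F (ract v m')) -linearB.
rewrite -[ract v m - _]v2rK (row_sum_delta (v2r _)) !linear_sum.
by apply: eq_bigr => l _; rewrite !linearZ linearB /= !mxE.
Qed.

End OrbitMap.

(** * Observable subgroups are stabilizers *)

Section Observability.
Variables (k : closedFieldType) (M : affineMonoid k) (H : M -> Prop).
Hypotheses (irrM : irreducible_variety M) (subgroupH : subgroup_of_units H).

Let H_inv h : H h -> exists2 h', H h' & (h * h' = 1)%g /\ (h' * h = 1)%g.
Proof.
have [Hunit _ _ HV] := subgroupH; move=> Hh.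
by have [h' [E1 E2]] := Hunit h Hh; exists h' => //; apply: HV E1 E2.
Qed.

(* Chevalley's construction: the translates of equations of [H] by [H] span a
   finite dimensional space, with basis [u]; the determinants of the elements of
   that basis at [d] points form a line that is stable exactly under [H]. *)
Lemma chevalley : zariski_closed H ->
  exists d (u : 'I_d -> M -> k) (p : 'I_d -> M) (chi : M -> k),
    let F (y : 'I_d -> M) := \det (\matrix_(i, j) u i (y j)) in
    [/\ forall i, regular (u i), F p != 0,
        forall h y, H h -> F (fun j => h * y j)%g = chi h * F y
      & forall m c, c != 0 ->
          (forall y, F (fun j => m * y j)%g = c * F y) -> H m].
Proof.
have [Hunit H1 HM _] := subgroupH.
move=> [S [regS SH]].
pose IH (f : M -> k) := regular f /\ forall h, H h -> f h = 0.
have idealIH : ideal IH.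
  split=> [f []||f g [rf f0] [rg g0]|f g rf [rg g0]] //; split.
  - exact: regular_cst.
  - by [].
  - exact: regularD.
  - by move=> h Hh; rewrite f0 // g0 // addr0.
  - exact: regularM.
  - by move=> h Hh; rewrite g0 // mulr0.
(* Finitely many equations cut out [H], so their translates lie in a finite dimensional space. *)
have [N [f [If fV]]] := noetherian_zeros idealIH.
have fH x : (forall j, f j x = 0) -> H x.
  move=> fx; apply/SH => s Ss; apply: fV fx _ _; split; first exact: regS.
  by move=> h /SH; apply.
pose T t := exists j h, H h /\ t = fun y : M => f j (h * y)%g.
have [I [b bP]] := separable_span (fun j => mulg_separable (If j).1).
have spanT t : T t -> exists c : I -> k, forall y, t y = \sum_i c i * b i y.
  by move=> [j [h [_ ->]]]; apply: bP.
have [d [u [p [Tu unitU tE]]]] := finite_rank_basis spanT.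
set U := \matrix_(i, j) _ in unitU tE.
have Tact t h : H h -> T t -> T (fun y => t (h * y)%g).
  move=> Hh [j [h' [Hh' ->]]]; exists j, (h' * h)%g; split; first exact: HM.
  by apply: functional_extensionality => y; rewrite mulgA.
pose C h := \matrix_(i, j) u i (h * p j)%g *m invmx U.
have uC h y : H h -> \col_i u i (h * y)%g = C h *m \col_i u i y.
  move=> Hh; apply/colP => i; rewrite mxE (tE _ (Tact _ _ Hh (Tu i)) y) /C.
  set r := \row_j _; have -> : r = row i (\matrix_(i, j) u i (h * p j)%g).
    by apply/rowP => j; rewrite !mxE.
  by rewrite -!row_mul mxE.
have uH i h : H h -> u i h = 0.
  by have [j [h' [Hh' ->]]] := Tu i => Hh; apply: (If j).2; apply: HM.
have uV x : (forall i, u i x = 0) -> H x.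
  move=> ux; apply: fH => j; rewrite -[x]mul1g.
  rewrite (tE (fun y => f j (1 * y)%g)); last by exists j, 1%g.
  by rewrite (_ : \col_i u i x = 0) ?mulmx0 ?mxE //; apply/colP => i; rewrite !mxE.
exists d, u, p, (fun h => \det (C h)) => F; split.
- move=> i; have [j [h [_ ->]]] := Tu i; apply: regular_mulgl; exact: (If j).1.
- by rewrite -unitfE -unitmxE.
- move=> h y Hh; rewrite /F -det_mulmx; congr (\det _); apply/matrixP => i j.
  have /colP/(_ i) := uC h (y j) Hh; rewrite !mxE => ->.
  by apply: eq_bigr => l _; rewrite !mxE.
- move=> m c c0 Fm.
  have FmP : \det (\matrix_(i, j) u i (m * p j)%g) != 0.
    by rewrite -[\det _]/(F (fun j => m * p j)%g) Fm mulf_neq0 // -unitfE -unitmxE.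
  suff um0 : \col_i u i m = 0.
    by apply: uV => i; have /colP/(_ i) := um0; rewrite !mxE.
  apply: det_replace_col_eq0 FmP _ => j0.
  (* At [1], which lies in [H], the basis vanishes, so [F y = 0] and [F (m y) = 0]: replacing a
     column of the invertible matrix at [m p] by the values at [m] gives determinant zero. *)
  pose y j := if j == j0 then 1%g else p j.
  have Fy : F y = 0.
    rewrite /F (expand_det_col _ j0) big1 // => i _.
    by rewrite mxE /y eqxx uH // mul0r.
  rewrite -[RHS](mulr0 c) -Fy -Fm; congr (\det _); apply/matrixP => i j.
  by rewrite !mxE /y; case: eqP => _; rewrite ?mulg1.
Qed.

Lemma observable_stabilizer : zariski_closed H -> observable_in H ->
  exists (V : rational_module M) (v : V), forall m, stab_group v m <-> H m.
Proof.
have [Hunit H1 HM _] := subgroupH.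
move=> closedH obs; have [d [u [p [chi [regu Fp Fchi Fline]]]]] := chevalley closedH.
set F := fun y : 'I_d -> M => \det (\matrix_(i, j) u i (y j)) in Fp Fchi Fline.
pose f0 m := F (fun j => m * p j)%g.
have regf0 : regular f0.
  apply: regular_det => i j.
  apply: eq_regular (regular_mulgr (p j) (regu i)) => m; by rewrite mxE.
have f0h h m : H h -> f0 (h * m)%g = chi h * f0 m.
  move=> Hh; rewrite /f0 -Fchi //; congr F.
  by apply: functional_extensionality => j; rewrite mulgA.
have f01 : f0 1%g <> 0.
  apply/eqP; rewrite /f0; suff -> : (fun j => 1 * p j)%g = p by [].
  by apply: functional_extensionality => j; rewrite mul1g.
have [||f [[q regq fE] [m1 fm1] finv]] := obs _ (principal_ideal_ideal regf0).
- move=> f h [q regq fE] Hh; exists (fun m => chi h * q (h * m)%g).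
    by apply: regularM; [exact: regular_cst | exact: regular_mulgl].
  by move=> m; rewrite fE f0h // mulrCA mulrA.
- exists f0; split; last by exists 1%g.
  by exists (fun _ => 1) => [|x]; [exact: regular_cst | rewrite mulr1].
(* [f0 q] is invariant and [f0] has weight [chi]; [f0] cancels because [k[M]] is a domain. *)
have qchi h m : H h -> chi h * q (h * m)%g = q m.
  move=> Hh; have regq' : regular (fun m => chi h * q (h * m)%g - q m).
    apply: regularB => //; apply: regularM; first exact: regular_cst.
    exact: regular_mulgl.
  have [x|f00|/(_ m)/eqP] := irreducible_domain irrM regf0 regq'.
  - have := finv h x Hh; rewrite !fE f0h // => E.
    by rewrite mulrBr -E mulrA [f0 x * _]mulrC subrr.
  - by case: f01.
  - by rewrite subr_eq0 => /eqP.
pose Y := (M * ('I_d -> M))%type.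
pose act (m : M) (z : Y) : Y := ((m * z.1)%g, fun j => (m * z.2 j)%g).
pose Phi (z : Y) := q z.1 * F z.2.
have sPhi : separable (fun m z => Phi (act m z)).
  apply: separableM.
    have [I [a [b [rega abE]]]] := mulg_separable regq.
    by exists I, a, (fun i z => b i z.1); split=> // m z; apply: abE.
  apply: separable_det => i j.
  have [I [a [b [rega abE]]]] := mulg_separable (regu i).
  by exists I, a, (fun l z => b l (z.2 j)); split=> // x z; rewrite mxE abE.
have [I [b bP]] := separable_span (fun _ : unit => sPhi).
have [||j y|n [w [A [repA wA w_inj rP]]]] :=
    translates_representation (act := act) (Phi := fun _ : unit => Phi) _ _ _ bP.
- move=> [m y]; rewrite /act mul1g /=; congr pair.
  by apply: functional_extensionality => j; rewrite mul1g.
- move=> m m' [y0 y]; rewrite /act mulgA /=; congr pair.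
  by apply: functional_extensionality => j; rewrite mulgA.
- exact: separable_regular y sPhi.
have [r rE] := rP tt.
exists (rep_module repA), r => m.
have stabE : rep_act A r m = r <-> forall z, Phi (act m z) = Phi z.
  split=> [E z|E]; first by rewrite !rE wA mulmxA -/(rep_act A r m) E.
  apply/eqP; rewrite -subr_eq0; apply/eqP/w_inj => z.
  apply/matrixP => i j; rewrite !ord1 [RHS]mxE mulmxBl -mulmxA -wA.
  by rewrite !mxE -[LHS]/(_ - _) ?rE; have := E z; rewrite !rE !mxE => ->; rewrite subrr.
split=> [[um /stabE E]|Hm].
  have qm1 : q m1 != 0.
    by apply/eqP => q0; apply: fm1; rewrite fE q0 mulr0.
  have qm : q (m * m1)%g != 0.
    have := E (m1, p); rewrite /Phi /=; apply: contra_eq_neq => ->.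
    by rewrite mul0r eq_sym mulf_neq0.
  (* Fixing the first argument at [m1] turns the invariance of [Phi] under [m] into a scaling of [F]
     by this ratio. *)
  apply: (Fline m (q m1 / q (m * m1)%g)) => [|y].
    by rewrite mulf_neq0 ?invr_eq0.
  have := E (m1, y); rewrite /Phi /= => Ey.
  by rewrite mulrAC -Ey mulrC mulKf.
split; first exact: Hunit.
apply/stabE => z; have Fm : F (act m z).2 = chi m * F z.2 := Fchi m z.2 Hm.
rewrite /Phi Fm mulrA [q _ * _]mulrC.
by rewrite qchi.
Qed.

(** * Stabilizers closed in [M] are observable *)

Section Stabilizer.
Variables (V : rational_module M) (v : V).
Hypothesis stabH : forall m, stab_group v m <-> H m.

Let pi := orbit_coord v.

Let reg_pi i : regular (pi i).
Proof. exact: orbit_coord_regular. Qed.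

Lemma stab_monoid_coord m : (forall i, pi i m - pi i 1%g = 0) -> stab_monoid v m.
Proof.
move=> E; rewrite /stab_monoid -[RHS](ract1 v).
by apply: orbit_coord_eq => i; apply/eqP; rewrite -subr_eq0 E.
Qed.

(* If [d] is the character whose nonzero set is the unit group, then [H] and
   [{d = 0}] cut [M_v] into two disjoint closed pieces, so that [d^s] lies in
   [d^(s+1) k[M] + m_v k[M]] for some [s]. *)
Lemma stabilizer_split (d : M -> k) : zariski_closed H -> regular d ->
  (forall m, unit_group m <-> d m != 0) ->
  exists s (c : M -> k) (b : 'I_(dim V) -> M -> k),
    [/\ regular c, forall i, regular (b i)
      & forall m, d m ^+ s =
          d m ^+ s.+1 * c m + \sum_i (pi i m - pi i 1%g) * b i m].
Proof.
move=> [S [regS SH]] regd unitd.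
(* Functions divisible by [d] on [H]. They have no common zero, as [d] does not vanish on [H]; so
   [K] contains [1], and [c] inverts [d] on [H]. *)
pose K (f : M -> k) := regular f /\ exists2 c, regular c &
  forall h, H h -> f h = d h * c h.
have idealK : ideal K.
  split=> [f []||f g [rf [b rb fE]] [rg [c rc gE]]|f g rf [rg [c rc gE]]] //; split.
  - exact: regular_cst.
  - by exists (fun _ => 0) => [|h]; [exact: regular_cst | rewrite mulr0].
  - exact: regularD.
  - exists (fun m => b m + c m) => [|h Hh]; first exact: regularD.
    by rewrite fE // gE // mulrDr.
  - exact: regularM.
  - exists (fun m => f m * c m) => [|h Hh]; first exact: regularM.
    by rewrite gE // mulrCA.
have [_ [c regc cE]] : K (fun _ => 1).
  apply: variety_weak_nullstellensatz idealK _ => x.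
  have [Hx|nHx] := classic (H x).
    exists d; last by apply/eqP/unitd; case: ((stabH x).2 Hx).
    split=> //; exists (fun _ => 1) => [|h _]; last by rewrite mulr1.
    exact: regular_cst.
  have [s [Ss sx]] : exists s, S s /\ s x <> 0.
    apply: NNPP => nex; apply/nHx/SH => s Ss; apply: NNPP => sx.
    by apply: nex; exists s.
  exists s => //; split; first exact: regS.
  exists (fun _ => 0) => [|h /SH sh]; first exact: regular_cst.
  by rewrite mulr0 sh.
pose Z (f : M -> k) := f = fun _ => 0.
have idealZ : ideal Z.
  split=> [f ->||f g -> ->|f g _ ->] //; first exact: regular_cst.
  - by apply: functional_extensionality => x; rewrite addr0.
  - by apply: functional_extensionality => x; rewrite mulr0.
have regdc : regular (fun m => 1 - d m * c m).
  by apply: regularB; [exact: regular_cst | exact: regularM].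
(* [d (1 - d c)] vanishes on [M_v]: a point of [M_v] with [d] nonzero is in [H], where [d c = 1].
   Its power is then expanded as [d^s (1 - d c')]. *)
have [x xV|s [_ [b [-> regb bE]]]] := variety_nullstellensatz
    (fiber_ideal_ideal 1%g reg_pi idealZ) (regularM regd regdc).
  have vx : stab_monoid v x.
    by apply: stab_monoid_coord => i; apply: xV (fiber_ideal_pi pi 1%g idealZ i).
  have [->|dx] := eqVneq (d x) 0; first by rewrite mul0r.
  have Hx : H x by apply/stabH; split=> //; apply/unitd.
  by rewrite -cE // subrr mulr0.
have [c' regc' c'E] : exists2 c', regular c' &
    forall m, (1 - d m * c m) ^+ s = 1 - d m * c' m.
  elim: {b regb bE} s => [|s [c' rc' c'E]].
    by exists (fun _ => 0) => [|m]; [exact: regular_cst | rewrite mulr0 subr0].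
  exists (fun m => c m + c' m * (1 - d m * c m)).
    by apply: regularD => //; apply: regularM.
  by move=> m; rewrite exprS c'E; ring.
exists s, c', b; split=> // m.
have := bE m; rewrite add0r exprMn c'E => <-.
by rewrite exprSr; ring.
Qed.

(* [d^s] vanishes in [k[M]/d^(s+1)] over every point of the orbit [v G], so it is
   a torsion element: some nonzero function of [v m] is divisible by [d]. *)
Lemma stab_monoid_unit m : zariski_closed H -> stab_monoid v m -> unit_group m.
Proof.
move=> closedH vm; have [d [regd d1 dM unitd]] := unit_character M.
have [s [c [b [regc regb bE]]]] := stabilizer_split closedH regd unitd.
have neq0 e : exists x, d x ^+ e <> 0.
  by exists 1%g; rewrite d1 expr1n; apply/eqP/oner_neq0.
have regds e : regular (fun x => d x ^+ e) by apply: regularX.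
have [a [[x0 ax0] [[b' regb' b'E]|fib]]] :=
  variety_generic irrM reg_pi (principal_ideal_ideal (regds s.+1)) (regds s).
  apply/unitd/eqP => dm0.
  have regdiff : regular (fun x => a.@[pi^~ x] - d x * b' x).
    by apply: regularB; [exact: regular_meval | exact: regularM].
  (* Torsion case: cancelling [d^s] leaves [a(v x) = d(x) b'(x)]. *)
  have [x|ds0|diff0] := irreducible_domain irrM (regds s) regdiff.
  - by rewrite mulrBr mulrC b'E exprSr; ring.
  - by have [x []] := neq0 s; apply: ds0.
  apply: ax0; have /eqP := diff0 (m * x0)%g; rewrite dM dm0 !mul0r subr0 => /eqP <-.
  apply: meval_eq => i; rewrite /pi /orbit_coord ractM.
  by move: vm; rewrite /stab_monoid => ->.
have rega : regular (fun x => a.@[pi^~ x]) by apply: regular_meval.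
have [||g /eqP] := irreducible_domain_neq0 irrM rega regd.
- by exists x0.
- by exists 1%g; rewrite d1; apply/eqP/oner_neq0.
rewrite mulf_eq0 negb_or => /andP[/eqP ag /unitd[g' [gg' g'g]]].
case: (fib g ag).
have dg : d g' * d g = 1 by rewrite -dM g'g.
pose e l i := v2r (ract (r2v (delta_mx 0 l) : V) g') 0 i.
(* The relation at the identity is evaluated at [x g'] and multiplied by [d(g)^s]; since
   [d(g') d(g) = 1], this puts [d^s] in the ideal over [v g]. *)
exists (fun x => d x ^+ s.+1 * (d g' * c (x * g')%g)).
exists (fun l x => \sum_i e l i * (b i (x * g')%g * d g ^+ s)); split.
- exists (fun x => d g' * c (x * g')%g) => //; apply: regularM.
    exact: regular_cst.
  exact: regular_mulgr.
- move=> l; apply: regular_sum => i; apply: regularM; first exact: regular_cst.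
  by apply: regularM; [exact: regular_mulgr | exact: regular_cst].
move=> x; transitivity (d (x * g')%g ^+ s * d g ^+ s).
  by rewrite dM -exprMn -mulrA dg mulr1.
rewrite bE mulrDl; congr (_ + _).
  transitivity (d x ^+ s.+1 * (d g' * c (x * g')%g) * (d g' * d g) ^+ s).
    by rewrite dM !exprMn [d g' ^+ s.+1]exprSr; ring.
  by rewrite dg expr1n mulr1.
rewrite mulr_suml.
under [RHS]eq_bigr do rewrite mulr_sumr.
rewrite exchange_big; apply: eq_bigr => i _ /=.
have -> : pi i (x * g')%g - pi i 1%g = \sum_l (pi l x - pi l g) * e l i.
  by rewrite -gg' /pi orbit_coord_mulg.
by rewrite !mulr_suml; apply: eq_bigr => l _; rewrite !mulrA.
Qed.

Lemma stabilizer_observable : zariski_closed H -> observable_in H.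
Proof.
move=> closedH I idealI stableI [f [If [x1 fx1]]].
have [Hunit H1 HM HV] := subgroupH.
have [regI _ _ _] := idealI; have regf := regI f If.
have [a [[x0 ax0] [Ia|fib]]] :=
  variety_generic irrM reg_pi idealI (regular_cst M 1).
  exists (fun x => a.@[pi^~ x] * 1); split=> //.
    by exists x0; rewrite mulr1.
  move=> h m Hh; congr (_ * _); apply: meval_eq => i.
  by rewrite /pi /orbit_coord ractM; have [_ ->] := (stabH h).2 Hh.
have [d [regd d1 dM unitd]] := unit_character M.
have rega : regular (fun x => a.@[pi^~ x]) by apply: regular_meval.
have [||x2 afx2] := irreducible_domain_neq0 irrM rega regf.
- by exists x0.
- by exists x1.
(* A generic [g]: it is invertible, [a(v g)] is nonzero and [g] is not a zero of [f]. *)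
have [||g /eqP] := irreducible_domain_neq0 irrM (regularM rega regf) regd.
- by exists x2.
- by exists 1%g; rewrite d1; apply/eqP/oner_neq0.
rewrite !mulf_eq0 !negb_or -andbA => /and3P[/eqP ag fg /unitd[g' [gg' g'g]]].
case: (fib g ag); apply: variety_weak_nullstellensatz.
  exact: fiber_ideal_ideal.
move=> x; apply: NNPP => nex.
have zero j : fiber_ideal pi I g j -> j x = 0.
  by move=> Ij; apply: NNPP => jx; apply: nex; exists j.
have vx : ract v x = ract v g.
  apply: orbit_coord_eq => i; apply/eqP; rewrite -subr_eq0; apply/eqP.
  exact: zero (fiber_ideal_pi pi g idealI i).
have Hxg : H (x * g')%g.
  have vxg : stab_monoid v (x * g')%g.
    by rewrite /stab_monoid ractM vx -ractM gg' ract1.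
  by apply/stabH; split=> //; exact: stab_monoid_unit.
have [h Hh [_ hxg]] := H_inv Hxg.
(* With [h] the inverse of [x g'], one has [h x = g]; the translate of [f] by [h] is in [I], so it
   vanishes at [x], giving [f g = 0]. *)
have := zero _ (fiber_idealW pi g (stableI f h If Hh)).
rewrite -[x]mulg1 -g'g [(x * _)%g]mulgA mulgA hxg mul1g => fg0.
by rewrite fg0 eqxx in fg.
Qed.

End Stabilizer.
End Observability.

Theorem theorem3p5 (k : closedFieldType) (M : affineMonoid k) (H : M -> Prop)
    (irrM : irreducible_variety M)
    (subgroupH : subgroup_of_units H)
    (closedH : zariski_closed H) :
  (observable_in H <->
     exists (V : rational_module M) (v : V),
       forall m : M, stab_group v m <-> H m)
  /\
  (forall (V : rational_module M) (v : V),
     (forall m : M, stab_group v m <-> H m) ->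
     (forall m : M, stab_group v m <-> stab_monoid v m) /\
     zariski_closed (stab_group v)).
Proof.
split.
  split=> [|[V [v stabH]]]; first exact: observable_stabilizer.
  exact: (stabilizer_observable irrM subgroupH stabH).
move=> V v stabH; split=> [m|].
  split=> [[] //|vm]; split=> //.
  exact: (stab_monoid_unit irrM stabH closedH vm).
have [S [regS SH]] := closedH.
by exists S; split=> // m; rewrite stabH.
Qed.
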